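(* Any constant angle spacelike surface in $\mathbf{E}_1^3$ is isometric to a plane, a cone, a cylinder or a tangent developable surface.
   Context: $\mathbf{E}_1^3$ is $\mathbb{R}^3$ with the Lorentzian metric $\langle\,,\rangle=dx_1^2+dx_2^2-dx_3^2$. A vector $w$ is timelike if $\langle w,w\rangle<0$, and $|w|=\sqrt{|\langle w,w\rangle|}$. A timelike vector $w$ is future-directed if $\langle w,(0,0,1)\rangle<0$. For timelike $a,b$ in the same timelike cone ($\langle a,b\rangle<0$) the hyperbolic angle is the unique $\theta\ge 0$ with $\langle a,b\rangle=-|a||b|\cosh\theta$. A smooth immersion $x:M\to\mathbf{E}_1^3$ of a connected surface is spacelike if the induced metric is Riemannian; equivalently its unit normal fields are timelike. The unit normal field $\xi$ is chosen future-directed. $M$ is a constant angle (spacelike) surface if there is a fixed timelike vector $U$ (taken unit and future-directed) such that $\xi$ makes a constant hyperbolic angle with $U$. A cylinder is a regular surface parametrized by $\gamma(s)+tv$ with $\gamma$ a regular curve and $v$ a fixed vector; a cone is a regular surface parametrized (up to translation) by $t\gamma(s)$ with $\gamma$ a regular curve; a tangent developable surface is a regular surface parametrized by $\gamma(s)+t\gamma'(s)$ with $\gamma$ a regular curve.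
   Formalization: ''Isometric'' is read locally: each point has a neighbourhood isometric to an open part of a plane, cone, cylinder or tangent developable, possibly varying with the point; globally the claim fails, e.g. for a once-punctured torus immersed in a spacelike plane. *)

(* Defs.v *)
From HB Require Import structures.
From mathcomp Require Import all_boot all_order all_algebra.
From mathcomp Require Import all_classical all_reals all_analysis.

Set Implicit Arguments.
Unset Strict Implicit.
Unset Printing Implicit Defensive.

Import Order.TTheory GRing.Theory Num.Theory.
Import numFieldNormedType.Exports.

Local Open Scope classical_set_scope.
Local Open Scope ring_scope.

Section Minkowski.
Variable R : realType.
Implicit Types (a b w : 'rV[R]_3).

Definition lprod a b : R :=
  a 0 0 * b 0 0 + a 0 1 * b 0 1 - a 0 2%:R * b 0 2%:R.

Definition timelike w := lprod w w < 0.

Definition lnorm w : R := Num.sqrt `|lprod w w|.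

Definition e3 : 'rV[R]_3 := delta_mx 0 2%:R.

Definition future_directed w := timelike w /\ lprod w e3 < 0.

Definition coshR (t : R) : R := (expR t + expR (- t)) / 2.

Definition hyperbolic_angle a b (theta : R) :=
  [/\ timelike a, timelike b, lprod a b < 0, 0 <= theta &
      lprod a b = - (lnorm a * lnorm b * coshR theta)].

End Minkowski.

Section Smoothness.
Variables (R : realType) (V W : normedModType R).

(* On an open set, being C^k for every k is the same as having directional
   derivatives of all orders, each of which is Frechet differentiable.  The
   predicate is only used with D open, so that ['D_v f] at a point of D
   depends only on the restriction of f to D. *)
Fixpoint Ck (k : nat) (D : set V) (f : V -> W) : Prop :=
  if k is k'.+1 then
    (forall q, D q -> differentiable f q) /\
    (forall v, Ck k' D (fun q => 'D_v f q))
  else forall q, D q -> {for q, continuous f}.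

Definition smooth_on (D : set V) (f : V -> W) := forall k, Ck k D f.

Definition immersion_on (D : set V) (f : V -> W) :=
  smooth_on D f /\ forall q, D q -> injective ('d f q : V -> W).

End Smoothness.

Section Surfaces.
Variables (R : realType) (T : topologicalType).

(* The maps are total; only their values on [chart_dom] and on
   [chart_range] are meaningful. *)
Record chart := Chart {
  chart_dom : set T;
  chart_map : T -> 'rV[R]_2;
  chart_inv : 'rV[R]_2 -> T }.

Definition chart_range (c : chart) : set 'rV[R]_2 :=
  chart_map c @` chart_dom c.

Definition is_chart (c : chart) :=
  [/\ open (chart_dom c), open (chart_range c),
      {within chart_dom c, continuous (chart_map c)},
      {within chart_range c, continuous (chart_inv c)} &
      forall p, chart_dom c p -> chart_inv c (chart_map c p) = p].

Definition smooth_transition (c c' : chart) :=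
  smooth_on (chart_map c @` (chart_dom c `&` chart_dom c'))
    (fun q => chart_map c' (chart_inv c q)).

Definition compatible (c c' : chart) :=
  smooth_transition c c' /\ smooth_transition c' c.

Definition smooth_atlas (A : set chart) :=
  [/\ forall c, A c -> is_chart c,
      forall p, exists2 c, A c & chart_dom c p &
      forall c c', A c -> A c' -> compatible c c'].

Definition connected_smooth_surface (A : set chart) :=
  [/\ hausdorff_space T, @second_countable T, connected [set: T] &
      smooth_atlas A].

(* A diffeomorphism from an open subset of the surface onto an open subset of
   the plane of parameters: a member of the maximal atlas containing A. *)
Definition smooth_chart (A : set chart) (c : chart) :=
  is_chart c /\ forall c', A c' -> compatible c c'.

Definition in_chart (W : Type) (x : T -> W) (c : chart) : 'rV[R]_2 -> W :=
  fun q => x (chart_inv c q).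

Definition smooth_map (W : normedModType R) (A : set chart) (x : T -> W) :=
  forall c, A c -> smooth_on (chart_range c) (in_chart x c).

Definition smooth_immersion (A : set chart) (x : T -> 'rV[R]_3) :=
  forall c, A c -> immersion_on (chart_range c) (in_chart x c).

End Surfaces.

Definition first_fundamental_form (R : realType)
    (X : 'rV[R]_2 -> 'rV[R]_3) (q v w : 'rV[R]_2) : R :=
  lprod ('d X q v) ('d X q w).

Section ConstantAngle.
Variables (R : realType) (T : topologicalType).
Variables (A : set (chart R T)) (x : T -> 'rV[R]_3).

Definition spacelike_immersion :=
  smooth_immersion A x /\
  forall c q v, A c -> chart_range c q -> v != 0 ->
    0 < first_fundamental_form (in_chart x c) q v v.

(* On a spacelike surface this field exists and is unique. *)
Definition future_unit_normal (xi : T -> 'rV[R]_3) :=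
  [/\ smooth_map A xi,
      forall p, lprod (xi p) (xi p) = -1,
      forall p, future_directed (xi p) &
      forall c q v, A c -> chart_range c q ->
        lprod (in_chart xi c q) ('d (in_chart x c) q v) = 0].

Definition constant_angle :=
  exists xi, future_unit_normal xi /\
    exists U, [/\ lprod U U = -1, future_directed U &
      exists theta, forall p, hyperbolic_angle (xi p) U theta].

End ConstantAngle.

Section ModelSurfaces.
Variable R : realType.
Implicit Types (D : set 'rV[R]_2) (Y : 'rV[R]_2 -> 'rV[R]_3).

(* The two parameters of q : 'rV_2 are s = q 0 0 and t = q 0 1. *)

Definition regular_surface D Y := open D /\ immersion_on D Y.

Definition regular_curve (I : set R) (gamma : R -> 'rV[R]_3) :=
  [/\ open I, is_interval I, smooth_on (I : set R^o) (gamma : R^o -> _) &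
      forall s, I s -> derive1 gamma s != 0].

Definition is_plane D Y :=
  [/\ regular_surface D Y, D = setT &
      exists P a b, forall q, Y q = P + q 0 0 *: a + q 0 1 *: b].

Definition is_cylinder D Y :=
  regular_surface D Y /\
  exists I gamma v, [/\ regular_curve I gamma,
    forall q, D q -> I (q 0 0) &
    forall q, D q -> Y q = gamma (q 0 0) + q 0 1 *: v].

Definition is_cone D Y :=
  regular_surface D Y /\
  exists I gamma P, [/\ regular_curve I gamma,
    forall q, D q -> I (q 0 0) &
    forall q, D q -> Y q = P + q 0 1 *: gamma (q 0 0)].

Definition is_tangent_developable D Y :=
  regular_surface D Y /\
  exists I gamma, [/\ regular_curve I gamma,
    forall q, D q -> I (q 0 0) &
    forall q, D q -> Y q = gamma (q 0 0) + q 0 1 *: derive1 gamma (q 0 0)].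

End ModelSurfaces.

(* The diffeomorphism [chart_map c] carries the open subset [chart_dom c] of
   the surface onto an open part of the parametrized surface (D, Y), and the
   two induced metrics, both read in the coordinates of c, coincide. *)
Definition isometric_onto_open_part (R : realType) (T : topologicalType)
    (A : set (chart R T)) (x : T -> 'rV[R]_3) (c : chart R T)
    (D : set 'rV[R]_2) (Y : 'rV[R]_2 -> 'rV[R]_3) :=
  [/\ smooth_chart A c, chart_range c `<=` D &
      forall q v w, chart_range c q ->
        first_fundamental_form (in_chart x c) q v w =
        first_fundamental_form Y q v w].

(* Every point of the surface has an open neighbourhood isometric to an open
   part of some member of the class C. *)
Definition locally_isometric_to (R : realType) (T : topologicalType)
    (A : set (chart R T)) (x : T -> 'rV[R]_3)
    (C : set 'rV[R]_2 -> ('rV[R]_2 -> 'rV[R]_3) -> Prop) :=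
  forall p, exists c, chart_dom c p /\
    exists D Y, C D Y /\ isometric_onto_open_part A x c D Y.

(* Main.v *)
(* A surface making a constant angle with [U] is flat: its Gauss map takes values
   in a circle. Flat coordinates can be written down. In an orthonormal frame
   (a, b, U) let X1, X2, X3 be the components of the immersion and let
   xi = (S cos psi, S sin psi, -C) with C = cosh theta and S^2 = C^2 - 1, so that
   C dX3 = - S (cos psi dX1 + sin psi dX2). The induced metric is e^2 + o^2 with
   e = (cos psi dX1 + sin psi dX2) / C and o = cos psi dX2 - sin psi dX1, and its
   connection form is C d(psi). Hence turning (e, o) through the angle C psi gives
   two closed 1-forms. By the Poincare lemma they are df1 and df2, so the metric is
   df1^2 + df2^2, and by the inverse function theorem (f1, f2) is a chart, in which
   the surface is an open part of the Euclidean plane. *)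
Require Import Defs.
From HB Require Import structures.
From mathcomp Require Import all_boot all_order all_algebra.
From mathcomp Require Import all_classical all_reals all_analysis.
From mathcomp Require Import ring lra.

Set Implicit Arguments.
Unset Strict Implicit.
Unset Printing Implicit Defensive.

Import Order.TTheory GRing.Theory Num.Theory.
Import numFieldNormedType.Exports.

Local Open Scope classical_set_scope.
Local Open Scope ring_scope.

(** * Differentiable and smooth functions *)

(** The components are the products against [a], [b] and [U]; the sign of the third is harmless,
    since the metric is quadratic in it. The relation for [dX3] says that [xi] is normal to the
    surface. It reads [dX3 = - S e], so the metric is [(C e)^2 + o^2 - (S e)^2 = e^2 + o^2].
    Differentiating it gives [S dpsi /\ o = 0], and this identity is what closes the forms: in
    [d(k e - l o)], with [(k, l)] the unit vector of angle [C psi], everything cancels except a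
    multiple of [(C - 1/C) dpsi /\ o], and [C - 1/C = S^2 / C]. No division by [S] occurs there, so
    a zero angle is covered too. The obstacle is [psi], which exists only locally and is
    undetermined when [S = 0]. The frame is therefore chosen for each point so that [xi] has
    positive product with [a] nearby, and [psi] is then an arctangent; when [S = 0], [xi] equals [U]
    and [psi = 0] serves. *)

Section Differentiability.
Variables (R : realType) (V W : normedModType R).
Implicit Types (f g : V -> W) (x v : V).

(** Lets a differential be identified from plain norm estimates, as is done below for inverse maps
    and for functions with continuous partials. *)
Lemma linear_approx_is_diff f x (df : {linear V -> W}) :
  continuous df ->
  (forall e, 0 < e ->
    \forall h \near 0, `|f (h + x) - f x - df h| <= e * `|h|) ->
  is_diff x f df.
Proof.
move=> cdf fdf.
have E : f \o shift x = cst (f x) + df +o_ 0 id.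
  apply/eqaddoP => _/posnumP[e].
  by apply: filterS (fdf e%:num ltac:(by [])) => h; rewrite /= opprD addrA.
have dfE := diff_unique cdf E.
by apply: DiffDef => //; apply/diff_locallyP; rewrite dfE.
Qed.

Lemma near_eq_is_diff f g x :
  {near x, f =1 g} -> differentiable f x -> is_diff x g ('d f x).
Proof.
move=> fg df; apply: linear_approx_is_diff; first exact: diff_continuous.
move=> e e0; have /eqaddoP/(_ e e0) := diff_locally df.
have fg' : \forall h \near (0 : V), f (h + x) = g (h + x).
  have := fg; rewrite (near_shift 0 x) /=; apply: filterS => h.
  by rewrite subr0.
apply: filterS2 fg' => h /= <-.
by rewrite !fctE /= opprD addrA (nbhs_singleton fg).
Qed.

Lemma eq_on_open_differentiable (D : set V) f g x :
  open D -> D x -> (forall q, D q -> f q = g q) ->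
  differentiable f x -> differentiable g x.
Proof.
move=> oD Dx fg df.
suff /near_eq_is_diff/(_ df)[] : {near x, f =1 g} by [].
by apply: filterS (open_nbhs_nbhs (conj oD Dx)) => q /fg.
Qed.

Lemma eq_on_open_derive (D : set V) f g x v :
  open D -> D x -> (forall q, D q -> f q = g q) -> 'D_v f x = 'D_v g x.
Proof.
move=> oD Dx fg; apply: near_eq_derive.
by apply: filterS (open_nbhs_nbhs (conj oD Dx)) => q /fg.
Qed.

End Differentiability.

(** * Closure properties of functions of class C^k *)

Section CkCalculus.
Variables (R : realType) (V : normedModType R).
Implicit Types (D : set V) (k : nat) (v q : V).

Lemma Ck_sub (W : normedModType R) k D D' (f : V -> W) :
  D' `<=` D -> Ck k D f -> Ck k D' f.
Proof.
move=> sD; elim: k f => [|k IH] f /= => [cf q /sD/cf //|[df Df]].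
by split=> [q /sD/df //|v]; exact/IH/Df.
Qed.

Lemma CkW (W : normedModType R) k D (f : V -> W) : Ck k.+1 D f -> Ck k D f.
Proof.
elim: k f => [|k IH] f [df Df].
  by move=> q /df/differentiable_continuous.
by split=> // v; exact/IH/Df.
Qed.

(** Rules for ['D_v] hold only at points of [D]. In the inductions on [k] the derivative is
    therefore replaced by a function agreeing with it on [D], and this lemma carries the regularity
    over. *)
Lemma eq_on_open_Ck (W : normedModType R) k D (f g : V -> W) : open D ->
  (forall q, D q -> f q = g q) -> Ck k D f -> Ck k D g.
Proof.
move=> oD; elim: k f g => [|k IH] f g fg /=.
  move=> cf q Dq; rewrite /prop_for /continuous_at -fg//.
  apply: cvg_trans (cf q Dq); apply: near_eq_cvg.
  by apply: filterS (open_nbhs_nbhs (conj oD Dq)) => p /fg.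
move=> [df Df]; split=> [q Dq|v].
  exact: (eq_on_open_differentiable oD Dq fg (df q Dq)).
by apply: IH (Df v) => q Dq; exact: (eq_on_open_derive v oD Dq fg).
Qed.

Lemma Ck_cst (W : normedModType R) k D (w : W) : Ck k D (fun=> w).
Proof.
elim: k w => [|k IH] w /=; first by move=> q _; exact: cvg_cst.
split=> [q _|v]; first exact: differentiable_cst.
by rewrite (_ : 'D_v _ = (fun=> 0))// funeqE => q; exact: derive_cst.
Qed.

Lemma Ck_add (W : normedModType R) k D (f g : V -> W) : open D ->
  Ck k D f -> Ck k D g -> Ck k D (fun q => f q + g q).
Proof.
move=> oD; elim: k f g => [|k IH] f g /=.
  by move=> cf cg q Dq; apply: cvgD; [exact: cf|exact: cg].
move=> [df Df] [dg Dg]; split=> [q Dq|v].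
  by apply: differentiableD; [exact: df|exact: dg].
apply: eq_on_open_Ck oD _ (IH _ _ (Df v) (Dg v)) => q Dq.
by rewrite deriveD//; apply: diff_derivable; [exact: df|exact: dg].
Qed.

Lemma Ck_mul k D (f g : V -> R) : open D ->
  Ck k D f -> Ck k D g -> Ck k D (fun q => f q * g q).
Proof.
move=> oD; elim: k f g => [|k IH] f g.
  by move=> cf cg q Dq; apply: cvgM; [exact: cf|exact: cg].
move=> Cf Cg; have [df Df] := Cf; have [dg Dg] := Cg; split=> [q Dq|v].
  by apply: differentiableM; [exact: df|exact: dg].
apply: eq_on_open_Ck oD _
  (Ck_add oD (IH _ _ (CkW Cf) (Dg v)) (IH _ _ (CkW Cg) (Df v))) => q Dq.
by rewrite deriveM//; apply: diff_derivable; [exact: df|exact: dg].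
Qed.

Lemma derive_comp1 (f : V -> R) (g : R -> R) (q v : V) (l : R) :
  differentiable f q -> is_derive (f q) 1 g l ->
  differentiable (g \o f) q /\ 'D_v (g \o f) q = l * 'D_v f q.
Proof.
move=> df [dg gl].
have dg' : differentiable g (f q) by exact/derivable1_diffP.
have dgf : differentiable (g \o f) q by exact: differentiable_comp.
split=> //; rewrite deriveE// diff_comp//= deriveE//.
rewrite -gl (deriveE _ dg') -[X in 'd g _ X = _]mulr1 [LHS]linearZ/=.
by rewrite mulrC.
Qed.

(** One step of a bootstrap, for functions such as [sin], [cos] and the inverse, whose derivative is
    expressed through composites already treated at order [k]. *)
Lemma Ck_comp1 k D (f : V -> R) (g g' : R -> R) : open D ->
  (forall q, D q -> is_derive (f q) 1 g (g' (f q))) ->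
  Ck k.+1 D f -> Ck k D (g' \o f) -> Ck k.+1 D (g \o f).
Proof.
move=> oD gg' Cf Cg'; have [df Df] := Cf.
have H q v Dq := derive_comp1 v (df q Dq) (gg' q Dq).
split=> [q Dq|v]; first exact: (H q 0 Dq).1.
apply: eq_on_open_Ck oD _ (Ck_mul oD Cg' (Df v)) => q Dq.
by rewrite (H q v Dq).2.
Qed.

Lemma Ck_coord n k D (f : V -> 'rV[R]_n) : open D ->
  Ck k D f <-> forall i, Ck k D (fun q => f q 0 i).
Proof.
move=> oD.
have coordE (g : V -> 'rV[R]_n) :
    g = (\sum_i (fun q => g q 0 i *: (delta_mx 0 i : 'rV[R]_n))).
  by apply/funext => q; rewrite fct_sumE {1}(row_sum_delta (g q)).
have dcoord (g : V -> 'rV[R]_n) (q : V) i : differentiable g q ->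
    differentiable (fun q => g q 0 i) q.
  move=> dg; apply: (@differentiable_comp _ _ _ _ g (fun M => M 0 i)) => //.
  exact: differentiable_coord.
split.
  elim: k f => [|k IH] f /=.
    move=> cf i q Dq.
    apply: (@continuous_comp _ _ _ f (fun M : 'rV[R]_n => M 0 i)).
      exact: cf.
    exact: coord_continuous.
  move=> [df Df] i; split=> [q /df /dcoord //|v].
  apply: eq_on_open_Ck oD _ (IH _ (Df v) i) => q Dq.
  by rewrite derive_mx ?mxE//; apply: diff_derivable; exact: df.
elim: k f => [|k IH] f /=.
  move=> cf q Dq; rewrite (coordE f) /prop_for /continuous_at fct_sumE.
  apply: cvg_big => [|i _]; first exact: add_continuous.
  by apply: cvgZr_tmp; exact: (cf i q Dq).
move=> Cf; have df q : D q -> differentiable f q.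
  move=> Dq; rewrite (coordE f); apply: differentiable_sum => i.
  by apply: differentiableZl; exact: (Cf i).1.
split=> [//|v]; apply: IH => i.
apply: eq_on_open_Ck oD _ ((Cf i).2 v) => q Dq.
by rewrite derive_mx ?mxE//; apply: diff_derivable; exact: df.
Qed.

End CkCalculus.
Section SmoothFunctions.
Variables (R : realType) (V : normedModType R).
Implicit Types (D : set V) (k : nat) (v q : V).

Lemma deriveErow n (W : normedModType R) (g : 'rV[R]_n -> W) (p w : 'rV[R]_n) :
  differentiable g p -> 'd g p w = \sum_j w 0 j *: 'D_(delta_mx 0 j) g p.
Proof.
move=> dg; rewrite {1}(row_sum_delta w) linear_sum; apply: eq_bigr => j _.
by rewrite linearZ/= deriveE.
Qed.

Lemma derive_comp (W W' : normedModType R) (f : V -> W) (g : W -> W') q v :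
  differentiable f q -> differentiable g (f q) ->
  'D_v (g \o f) q = 'd g (f q) ('D_v f q).
Proof.
move=> df dg; have dgf := differentiable_comp df dg.
by rewrite (deriveE _ dgf) (deriveE _ df) (diff_comp df dg).
Qed.

Lemma Ck_sum k D (I : Type) (r : seq I) (W : normedModType R) (f : I -> V -> W) :
  open D -> (forall i, Ck k D (f i)) -> Ck k D (fun q => \sum_(i <- r) f i q).
Proof.
move=> oD Cf; elim: r => [|i r IH].
  by apply: eq_on_open_Ck oD _ (Ck_cst k D 0) => q _; rewrite big_nil.
apply: eq_on_open_Ck oD _ (Ck_add oD (Cf i) IH) => q _.
by rewrite big_cons.
Qed.

Lemma Ck_prod k D (I : Type) (r : seq I) (f : I -> V -> R) :
  open D -> (forall i, Ck k D (f i)) -> Ck k D (fun q => \prod_(i <- r) f i q).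
Proof.
move=> oD Cf; elim: r => [|i r IH].
  by apply: eq_on_open_Ck oD _ (Ck_cst k D (1 : R)) => q _; rewrite big_nil.
apply: eq_on_open_Ck oD _ (Ck_mul oD (Cf i) IH) => q _.
by rewrite big_cons.
Qed.

(** By the chain rule the derivative of the composite is the sum over [j] of the [j]-th entry of
    ['D_v f] times the [j]-th partial of [g] taken at [f]. The induction keeps [g] general so as to
    apply to these partials. *)
Lemma Ck_comp n k D (E : set 'rV[R]_n) (f : V -> 'rV[R]_n) (g : 'rV[R]_n -> R) :
  open D -> (forall q, D q -> E (f q)) ->
  Ck k D f -> Ck k E g -> Ck k D (g \o f).
Proof.
move=> oD DE; elim: k g => [|k IH] g.
  move=> cf cg q Dq; apply: continuous_comp; first exact: cf.
  exact/cg/DE.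
move=> Cf [dg Dg]; have [df Df] := Cf.
split=> [q Dq|v].
  by apply: differentiable_comp; [exact: df|exact/dg/DE].
have Cfj j : Ck k D (fun q => 'D_v f q 0 j) by exact: (Ck_coord k ('D_v f) oD).1 (Df v) j.
apply: eq_on_open_Ck oD _ (Ck_sum (index_enum 'I_n) oD
    (fun j => Ck_mul oD (Cfj j) (IH _ (CkW Cf) (Dg (delta_mx 0 j))))) => q Dq.
by rewrite (derive_comp v (df q Dq) (dg _ (DE q Dq))) (deriveErow _ (dg _ (DE q Dq))).
Qed.

Lemma smooth_sub (W : normedModType R) D D' (f : V -> W) :
  D' `<=` D -> smooth_on D f -> smooth_on D' f.
Proof. by move=> sD Df k; exact: Ck_sub sD (Df k). Qed.

Lemma smooth_eq_on_open (W : normedModType R) D (f g : V -> W) : open D ->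
  (forall q, D q -> f q = g q) -> smooth_on D f -> smooth_on D g.
Proof. by move=> oD fg Df k; exact: eq_on_open_Ck oD fg (Df k). Qed.

Lemma smooth_differentiable (W : normedModType R) D (f : V -> W) q :
  smooth_on D f -> D q -> differentiable f q.
Proof. by move=> /(_ 1%N)[df _] /df. Qed.

Lemma smooth_continuous (W : normedModType R) D (f : V -> W) q :
  smooth_on D f -> D q -> {for q, continuous f}.
Proof. by move=> /(_ 0%N); exact. Qed.

Lemma smooth_derive (W : normedModType R) D (f : V -> W) v :
  smooth_on D f -> smooth_on D ('D_v f).
Proof. by move=> Df k; have [_] := Df k.+1; exact. Qed.

Lemma smooth_of_derive (W : normedModType R) D (f : V -> W) :
  (forall q, D q -> differentiable f q) ->
  (forall v, smooth_on D ('D_v f)) -> smooth_on D f.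
Proof.
move=> df Df [|k]; first by move=> q /df/differentiable_continuous.
by split=> // v; exact: Df.
Qed.

Lemma smooth_cst (W : normedModType R) D (w : W) : smooth_on D (fun=> w).
Proof. by move=> k; exact: Ck_cst. Qed.

Lemma smooth_add (W : normedModType R) D (f g : V -> W) : open D ->
  smooth_on D f -> smooth_on D g -> smooth_on D (fun q => f q + g q).
Proof. by move=> oD Df Dg k; exact: Ck_add. Qed.

Lemma smooth_mul D (f g : V -> R) : open D ->
  smooth_on D f -> smooth_on D g -> smooth_on D (fun q => f q * g q).
Proof. by move=> oD Df Dg k; exact: Ck_mul. Qed.

Lemma smooth_opp D (f : V -> R) : open D ->
  smooth_on D f -> smooth_on D (fun q => - f q).
Proof.
move=> oD Df; apply: smooth_eq_on_open oD _
  (smooth_mul oD (smooth_cst (W := R) D (-1)) Df) => q _.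
by rewrite mulN1r.
Qed.

Lemma smooth_sum D (I : Type) (r : seq I) (W : normedModType R)
    (f : I -> V -> W) : open D -> (forall i, smooth_on D (f i)) ->
  smooth_on D (fun q => \sum_(i <- r) f i q).
Proof. by move=> oD Df k; apply: Ck_sum => // i; exact: Df. Qed.

Lemma smooth_prod D (I : Type) (r : seq I) (f : I -> V -> R) : open D ->
  (forall i, smooth_on D (f i)) -> smooth_on D (fun q => \prod_(i <- r) f i q).
Proof. by move=> oD Df k; apply: Ck_prod => // i; exact: Df. Qed.

Lemma smooth_coord n D (f : V -> 'rV[R]_n) : open D ->
  smooth_on D f <-> forall i, smooth_on D (fun q => f q 0 i).
Proof.
move=> oD; split=> [Df i k|Df k]; first exact: (Ck_coord k f oD).1.
by apply/(Ck_coord k f oD) => i; exact: Df.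
Qed.

Lemma smooth_comp n m D (E : set 'rV[R]_n) (f : V -> 'rV[R]_n)
    (g : 'rV[R]_n -> 'rV[R]_m) : open D -> open E ->
  (forall q, D q -> E (f q)) ->
  smooth_on D f -> smooth_on E g -> smooth_on D (g \o f).
Proof.
move=> oD oE DE Df Eg; apply/smooth_coord => // i k.
exact: (Ck_comp oD DE (Df k) ((Ck_coord k g oE).1 (Eg k) i)).
Qed.

Lemma smooth_sin_cos D (f : V -> R) : open D -> smooth_on D f ->
  smooth_on D (@sin R \o f) /\ smooth_on D (@cos R \o f).
Proof.
move=> oD Df.
(* Each is the derivative of the other up to sign, so the induction treats both at once. *)
suff H k : Ck k D (@sin R \o f) /\ Ck k D (@cos R \o f).
  by split=> k; have [] := H k.
elim: k => [|k [Cs Cc]].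
  have cf q (Dq : D q) := smooth_continuous Df Dq.
  by split=> q Dq; apply: continuous_comp; [exact: cf|exact: continuous_sin|
    exact: cf|exact: continuous_cos].
split; first by apply: (Ck_comp1 (g' := @cos R) oD _ (Df _) Cc).
apply: (Ck_comp1 (g' := fun x => - sin x) oD _ (Df _) _) => //.
apply: eq_on_open_Ck oD _ (Ck_mul oD (Ck_cst (W := R) k D (-1)) Cs) => q _ /=.
by rewrite mulN1r.
Qed.

Lemma smooth_inv D (f : V -> R) : open D -> (forall q, D q -> f q != 0) ->
  smooth_on D f -> smooth_on D (fun q => (f q)^-1).
Proof.
move=> oD f0 Df; elim=> [|k IH].
  move=> q Dq; apply: cvgV; first exact: f0.
  exact: smooth_continuous Df Dq.
(* The derivative is a polynomial in the inverse itself, so [IH] suffices for it. *)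
apply: (Ck_comp1 (g := @GRing.inv R) (g' := fun x => - (x^-1 * x^-1)) oD _ (Df _) _).
  move=> q Dq; have /derivable1_diffP dV := differentiable_Rinv (f0 q Dq).
  apply: DeriveDef => //.
  rewrite deriveV ?derive_id//; last exact: f0.
  by rewrite /GRing.scale/= mulr1 expr2 invfM.
apply: eq_on_open_Ck oD _
  (Ck_mul oD (Ck_cst (W := R) k D (-1)) (Ck_mul oD IH IH)) => q _ /=.
by rewrite mulN1r.
Qed.

Lemma smooth_atan D (f : V -> R) : open D ->
  smooth_on D f -> smooth_on D (@atan R \o f).
Proof.
move=> oD Df [|k].
  move=> q Dq; apply: continuous_comp; last exact: continuous_atan.
  exact: smooth_continuous Df Dq.
apply: (Ck_comp1 (g' := fun x => (1 + x ^+ 2)^-1) oD _ (Df _) _) => //.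
apply: (smooth_inv (f := fun q => 1 + f q ^+ 2) oD).
  by move=> q _; rewrite gt_eqF// ltr_pwDl// sqr_ge0.
apply: smooth_add => //; first exact: (smooth_cst (W := R)).
by under eq_fun do rewrite expr2; exact: smooth_mul.
Qed.

End SmoothFunctions.
(** * The inverse function theorem *)

Section RowNorm.
Variables (R : realType).

Lemma row_coord_le_norm n (v : 'rV[R]_n) j : `|v 0 j| <= `|v|.
Proof.
rewrite [leRHS]/Num.Def.normr/= mx_normrE.
exact: (le_bigmax _ (fun ij : 'I_1 * 'I_n => `|v ij.1 ij.2|) (ord0, j)).
Qed.

Lemma row_norm_le n (v : 'rV[R]_n) e :
  0 <= e -> (forall j, `|v 0 j| <= e) -> `|v| <= e.
Proof.
move=> e0 ve; rewrite [leLHS]/Num.Def.normr/= mx_normrE.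
by apply: bigmax_le => // -[i j] _ /=; rewrite (ord1 i).
Qed.

Lemma mulmx_bound n m (N : 'M[R]_(n, m)) :
  exists2 k, 0 < k & forall v : 'rV[R]_n, `|v *m N| <= k * `|v|.
Proof.
pose s := \sum_i \sum_j `|N i j|.
have s0 : 0 <= s by apply: sumr_ge0 => i _; exact: sumr_ge0.
exists (s + 1); first by rewrite ltr_pwDr.
move=> v; apply: row_norm_le => [|j]; first by rewrite mulr_ge0// addr_ge0.
rewrite mxE (le_trans (ler_norm_sum _ _ _))//.
rewrite (@le_trans _ _ (\sum_i `|v| * `|N i j|))//.
  apply: ler_sum => i _; rewrite normrM ler_wpM2r//.
  exact: row_coord_le_norm.
rewrite -mulr_sumr mulrC ler_wpM2r// (@le_trans _ _ s) ?lerDl//.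
apply: ler_sum => i _; rewrite (bigD1 j)//= lerDl.
exact: sumr_ge0.
Qed.

Lemma smooth_entry n (j : 'I_n) : smooth_on setT (fun v : 'rV[R]_n => v 0 j).
Proof.
suff : smooth_on setT (@id 'rV[R]_n) by move=> /(smooth_coord _ openT); exact.
apply: smooth_of_derive => [q _|v]; first exact: (@ex_diff _ _ _ _ _ id id).
rewrite (_ : 'D_v id = cst v); first exact: smooth_cst.
by apply/funext => q; rewrite derive_id.
Qed.

Lemma smooth_mulmxr n m (N : 'M[R]_(n, m)) :
  smooth_on setT (fun v : 'rV[R]_n => v *m N).
Proof.
apply/(smooth_coord _ openT) => j.
apply: (smooth_eq_on_open openT _ (smooth_sum (index_enum 'I_n) openT
  (fun i => smooth_mul openT (smooth_entry i)
                             (smooth_cst (W := R) setT (N i j))))) => v _.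
by rewrite mxE.
Qed.

Lemma mulmxr_continuous n m (N : 'M[R]_(n, m)) :
  continuous (fun v : 'rV[R]_n => v *m N).
Proof. by move=> v; exact: smooth_continuous (smooth_mulmxr N) _. Qed.

(** In the sup norm a closed ball is a product of segments. *)
Lemma compact_row_box n (c : 'rV[R]_n) (r : R) :
  0 <= r -> compact [set p | `|p - c| <= r].
Proof.
move=> r0; rewrite (_ : [set p | _] =
    [set p : 'rV[R]_n | forall i, `[c 0 i - r, c 0 i + r]%classic (p 0 i)]).
  apply: (@rV_compact R n (fun i => `[c 0 i - r, c 0 i + r]%classic)) => i.
  exact: segment_compact.
apply/seteqP; split=> p /=.
  move=> pc i; have := le_trans (row_coord_le_norm (p - c) i) pc.
  by rewrite !mxE ler_distl in_itv.
move=> pc; apply: row_norm_le => // j.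
by have := pc j; rewrite !mxE ler_distl in_itv.
Qed.

(** The mean value theorem on the segment from [p'] to [p], which stays in the ball by convexity;
    the factor [n] counts the partial derivatives. *)
Lemma mean_value_row n (c : 'rV[R]_n) r (g : 'rV[R]_n -> R) e :
  (forall p, ball c r p -> differentiable g p) ->
  (forall p j, ball c r p -> `|'D_(delta_mx 0 j) g p| <= e) ->
  forall p p', ball c r p -> ball c r p' ->
  `|g p - g p'| <= n%:R * e * `|p - p'|.
Proof.
move=> dg ge p p' Bp Bp'; pose h (t : R) : R := g (t *: (p - p') + p').
have Bt (t : R) : t \in `[0, 1] -> ball c r (t *: (p - p') + p').
  rewrite in_itv/= => /andP[t0 t1].
  move: Bp Bp'; rewrite -!ball_normE/= => Bp Bp'.
  have -> : c - (t *: (p - p') + p') = t *: (c - p) + (1 - t) *: (c - p').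
    by apply/rowP => j; rewrite !mxE; ring.
  rewrite (le_lt_trans (ler_normD _ _))// !normrZ ger0_norm//.
  rewrite ger0_norm ?subr_ge0//.
  (* The strict inequality is taken from the weight [t] of [p], hence the separate case [t = 0]. *)
  case: (ltgtP t 0) t0 => // [t0 _|-> _]; last by rewrite mul0r add0r subr0 mul1r.
  have : 0 < t * (r - `|c - p|) by rewrite mulr_gt0// subr_gt0.
  have : 0 <= (1 - t) * (r - `|c - p'|) by rewrite mulr_ge0 ?subr_ge0// ltW.
  by lra.
have dh (t : R) : t \in `[0, 1] -> is_derive t 1 h ('D_(p - p') g (t *: (p - p') + p')).
  move=> /Bt/dg dgt.
  pose a (t : R) := t *: (p - p') + p'.
  have ada : is_diff t a ( *:%R^~ (p - p')).
    rewrite /a (_ : (fun t => _) = ( *:%R^~ (p - p') + cst p')); last by apply/funext.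
    apply: is_diff_eq; by rewrite addr0.
  have dga := differentiable_comp (@ex_diff _ _ _ _ _ _ _ ada) dgt.
  apply: DeriveDef; first exact/derivable1_diffP.
  rewrite (deriveE _ dga) (diff_comp (@ex_diff _ _ _ _ _ _ _ ada) dgt)/=.
  by rewrite (@diff_val _ _ _ _ _ _ _ ada) scale1r deriveE.
have dh' (t : R) : t \in `]0, 1[ ->
    is_derive t 1 h ('D_(p - p') g (t *: (p - p') + p')).
  by move=> t01; apply: dh; exact: subset_itv_oo_cc.
have ch : {within `[0, 1], continuous h}.
  by apply: derivable_within_continuous => t /dh [].
have [t t01] := MVT_segment ler01 dh' ch.
rewrite /h scale0r scale1r add0r subrK subr0 mulr1 => ->.
rewrite (deriveE _ (dg _ (Bt _ t01))) (deriveErow _ (dg _ (Bt _ t01))).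
rewrite (le_trans (ler_norm_sum _ _ _))//.
rewrite (@le_trans _ _ (\sum_(i < n) e * `|p - p'|))//.
  apply: ler_sum => j _; rewrite normrM mulrC ler_pM//.
    exact/ge/Bt.
  exact: row_coord_le_norm.
by rewrite sumr_const card_ord -mulrA mulr_natl.
Qed.

End RowNorm.
Section InverseFunction.
Variable R : realType.

Lemma smooth_det (V : normedModType R) (D : set V) n (M : V -> 'M[R]_n) :
  open D -> (forall i j, smooth_on D (fun q => M q i j)) ->
  smooth_on D (fun q => \det (M q)).
Proof.
move=> oD sM; apply: smooth_sum => // s; apply: smooth_mul => //.
  exact: (smooth_cst (W := R)).
exact: smooth_prod.
Qed.

(** Cramer's rule: the entries of the inverse are cofactors divided by the determinant. *)
Lemma smooth_invmx (V : normedModType R) (D : set V) n (M : V -> 'M[R]_n) :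
  open D -> (forall q, D q -> \det (M q) != 0) ->
  (forall i j, smooth_on D (fun q => M q i j)) ->
  forall i j, smooth_on D (fun q => invmx (M q) i j).
Proof.
move=> oD M0 sM i j.
have smc : smooth_on D (fun q => cofactor (M q) j i).
  apply: smooth_mul => //; first exact: (smooth_cst (W := R)).
  apply: smooth_det => // k l.
  by apply: (smooth_eq_on_open oD _ (sM (lift j k) (lift i l))) => q _; rewrite !mxE.
apply: (smooth_eq_on_open oD _
  (smooth_mul oD (smooth_inv oD M0 (smooth_det oD sM)) smc)) => q Dq.
by rewrite /invmx unitmxE unitfE M0// !mxE.
Qed.

(** The Jacobian acts on row vectors from the right, so its row index is the direction of
    differentiation. *)
Lemma jacobian_entry n m (F : 'rV[R]_n -> 'rV[R]_m) p i j :
  differentiable F p -> 'J F p i j = 'D_(delta_mx 0 i) (fun q => F q 0 j) p.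
Proof.
move=> dF; rewrite mxE -deriveE// derive_mx ?mxE//.
exact: diff_derivable.
Qed.

Lemma smooth_jacobian n m (D : set 'rV[R]_n) (F : 'rV[R]_n -> 'rV[R]_m) :
  open D -> smooth_on D F -> forall i j, smooth_on D (fun p => 'J F p i j).
Proof.
move=> oD sF i j; have sFj := (smooth_coord _ oD).1 sF j.
apply: smooth_eq_on_open oD _ (smooth_derive (delta_mx 0 i) sFj) => p Dp.
by rewrite jacobian_entry//; exact: smooth_differentiable sF Dp.
Qed.

Lemma lipschitz_continuous_at (V W : normedModType R) (f : V -> W) q k :
  0 < k -> (\forall p \near q, `|f q - f p| <= k * `|q - p|) ->
  {for q, continuous f}.
Proof.
move=> k0 fk; apply/cvgrPdist_le => e e0; near=> p.
have /le_trans-> // : `|f q - f p| <= k * `|q - p| by near: p.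
rewrite -ler_pdivlMl//; near: p.
by apply: cvgr_dist_le => //; rewrite mulr_gt0// invr_gt0.
Unshelve. all: by end_near. Qed.

(* [H] is a Lipschitz-small perturbation of the identity; a preimage of [y] is
   a minimiser [m] of [|H p - y|] on a closed box, since otherwise
   [m + y - H m] would do better. *)
Lemma near_identity_open_image n (c : 'rV[R]_n) r (H : 'rV[R]_n -> 'rV[R]_n) :
  (forall (p p' : 'rV[R]_n), ball c r p -> ball c r p' ->
     `|(p - p') - (H p - H p')| <= 2^-1 * `|p - p'|) ->
  open (H @` ball c r).
Proof.
move=> Hid; rewrite openE => _ [q Bq <-]; move: q Bq.
suff : forall q : 'rV[R]_n, ball c r q -> nbhs (H q) (H @` ball c r) by [].
move=> q Bq.
have cq : `|c - q| < r by move: Bq; rewrite -ball_normE.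
pose s := (r - `|c - q|) / 2.
have s0 : 0 < s by rewrite divr_gt0// subr_gt0.
have sB (p : 'rV[R]_n) : `|p - q| <= s -> ball c r p.
  move=> pq; rewrite -ball_normE/=.
  have := ler_normD (c - q) (q - p); rewrite subrKA (distrC q p).
  by rewrite /s in s0 pq; lra.
have H2 (p p' : 'rV[R]_n) : ball c r p -> ball c r p' -> `|H p - H p'| <= 2 * `|p - p'|.
  move=> Bp Bp'; have := Hid p p' Bp Bp'.
  have := ler_normB (p - p') ((p - p') - (H p - H p')).
  by rewrite opprB addrCA subrr addr0; have := normr_ge0 (p - p'); lra.
(* The corrected point [m'] below satisfies [m' - q = (y - H q) + ((m - q) - (H m - H q))]. Both
   terms are bounded by [s / 2], so [m'] stays in the box of radius [s]. *)
apply/nbhs_ballP; exists (s / 2) => /=; first by rewrite divr_gt0.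
move=> y; rewrite -ball_normE/= => yq.
pose A := [set p : 'rV[R]_n | `|p - q| <= s].
have cA : {within A, continuous (fun p => `|H p - y|)}.
  apply: continuous_in_subspaceT => p /set_mem pA.
  apply: (@lipschitz_continuous_at _ _ _ _ 2) => //.
  have Bp : nbhs p (ball c r).
    by apply: open_nbhs_nbhs; split; [exact: ball_open|exact: sB].
  apply: filterS Bp => p' Bp'; rewrite (le_trans (ler_dist_dist _ _))//.
  by rewrite opprB addrA subrK; apply: H2 => //; exact: sB.
have A0 : A !=set0 by exists q; rewrite /A/= subrr normr0 ltW.
have [m /set_mem Am minm] := EVT_min_rV A0 (compact_row_box (ltW s0)) cA.
have Bm := sB _ Am.
have [Hmy|Hmy] := eqVneq (H m) y.
  by exists m => //; move: Bm; rewrite -ball_normE.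
pose m' := m + (y - H m).
have Am' : A m'.
  have := Hid m q Bm Bq.
  have := ler_normD (y - H q) ((m - q) - (H m - H q)).
  rewrite (_ : (y - H q) + _ = m' - q); last first.
    by rewrite /m'; apply/rowP => j; rewrite !mxE; ring.
  by rewrite (distrC y); move: Am; rewrite /A/=; lra.
have := minm m' (mem_set Am'); rewrite leNgt => /negP[].
have := Hid m' m (sB _ Am') Bm.
rewrite (_ : (m' - m) - _ = y - H m'); last first.
  by rewrite /m'; apply/rowP => j; rewrite !mxE; ring.
rewrite (_ : m' - m = y - H m); last by rewrite /m' addrC addKr.
have : 0 < `|H m - y| by rewrite normr_gt0 subr_eq0.
by rewrite !(distrC y); lra.
Qed.

(** Multiplying the first order expansion of [F] by the inverse Jacobian gives that of [G]; the
    Lipschitz bound on the inverse turns an error small against [p' - p] into one small against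
    [F p' - F p]. *)
Lemma inverse_is_diff n (B : set 'rV[R]_n) (F G : 'rV[R]_n -> 'rV[R]_n)
    k p : 0 < k -> open (F @` B) -> B p ->
  (forall p, B p -> G (F p) = p) ->
  (forall p', B p' -> `|p' - p| <= k * `|F p' - F p|) ->
  differentiable F p -> \det ('J F p) != 0 ->
  is_diff (F p) G (fun v => v *m invmx ('J F p)).
Proof.
move=> k0 oFB Bp GF FL dF J0.
have uJ : 'J F p \in unitmx by rewrite unitmxE unitfE.
have [k' k'0 Nk'] := mulmx_bound (invmx ('J F p)).
apply: (@linear_approx_is_diff R _ _ G (F p) (mulmxr (invmx ('J F p)))).
  exact: mulmxr_continuous.
move=> e e0.
(* The error is later multiplied by [k'], from the inverse Jacobian, and by [k], from the Lipschitz
   bound. *)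
have e'0 : 0 < e / (k' * k) by rewrite divr_gt0// mulr_gt0.
have /eqaddoP/(_ _ e'0) := diff_locally dF.
move=> /nbhs_ballP[d /= d0 dP].
have FBp : nbhs (F p) (F @` B) by apply: open_nbhs_nbhs; split=> //; exists p.
have /nbhs_ballP[d' /= d'0 d'P] := FBp; apply/nbhs_ballP.
(* The radius [d'] keeps [h + F p] in the image, and [d / k] brings its preimage within [d] of
   [p]. *)
exists (Num.min d' (d / k)) => /=; first by rewrite lt_min d'0 divr_gt0.
move=> h; rewrite -ball_normE/= sub0r normrN lt_min => /andP[hd' hd].
have [p' Bp' Fp'] : (F @` B) (h + F p).
  by apply: d'P; rewrite -ball_normE/= opprD addrCA subrr addr0 normrN.
rewrite -Fp' !GF//.
have hE : h = F p' - F p by rewrite Fp' addrK.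
have p'p := FL p' Bp'; rewrite -hE in p'p.
have := dP (p' - p); rewrite -ball_normE/= sub0r normrN => /(_ _)/le_trans.
have : `|p' - p| < d by rewrite (le_lt_trans p'p)// mulrC -ltr_pdivlMr.
move=> /[swap] /[apply].
rewrite !fctE/= subrK => dPp'.
rewrite (_ : p' - p - h *m _ =
  - ((F p' - (F p + 'd F p (p' - p))) *m invmx ('J F p))); last first.
  rewrite opprD addrA -hE mulmxBl opprB; congr (_ - _).
  by rewrite -(mul_rV_lin1 ('d F p)) -mulmxA -/(jacobian F p) mulmxV// mulmx1.
rewrite normrN (le_trans (Nk' _))// (le_trans (ler_wpM2l (ltW k'0) (dPp' _ (lexx _))))//.
rewrite (le_trans (ler_wpM2l (ltW k'0) (ler_wpM2l (ltW e'0) p'p)))//.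
by rewrite le_eqVlt; apply/orP; left; apply/eqP; field; rewrite !gt_eqF.
Qed.

(** The derivative of [G] at [y] is the inverse Jacobian of [F] at [G y], so [G] of class C^k has
    derivatives of class C^k. *)
Lemma inverse_smooth n (B : set 'rV[R]_n) (F G : 'rV[R]_n -> 'rV[R]_n) :
  open B -> open (F @` B) -> smooth_on B F ->
  (forall p, B p -> \det ('J F p) != 0) ->
  (forall p, B p -> G (F p) = p) ->
  (forall p, B p -> is_diff (F p) G (fun v => v *m invmx ('J F p))) ->
  smooth_on (F @` B) G.
Proof.
move=> oB oFB sF J0 GF dG.
have sN := smooth_invmx oB J0 (smooth_jacobian oB sF).
have FG y : (F @` B) y -> B (G y) /\ F (G y) = y.
  by move=> [p Bp <-]; rewrite GF.
have dG' y : (F @` B) y -> differentiable G y.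
  by move=> [p Bp <-]; exact: (@ex_diff _ _ _ _ _ _ _ (dG p Bp)).
elim=> [|k IH]; first by move=> y /dG'/differentiable_continuous.
split=> // v; apply/(Ck_coord _ _ oFB) => j.
have C i : Ck k (F @` B) (fun y => v 0 i * invmx ('J F (G y)) i j).
  apply: Ck_mul => //; first exact: (Ck_cst (W := R)).
  by apply: (Ck_comp oFB _ IH (sN i j k)) => y /FG[].
apply: (eq_on_open_Ck oFB _ (Ck_sum (index_enum 'I_n) oFB C)) => _ [p Bp <-].
rewrite (deriveE _ (dG' _ (imageP _ Bp))) (@diff_val _ _ _ _ _ _ _ (dG p Bp)).
by rewrite GF// mxE.
Qed.

Lemma derive_mulmxr n m l (F : 'rV[R]_n -> 'rV[R]_m) (N : 'M[R]_(m, l)) p v :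
  differentiable F p ->
  'D_v (fun q => F q *m N) p = 'D_v F p *m N.
Proof.
move=> dF.
have dN : is_diff (F p) (fun w : 'rV[R]_m => w *m N) (fun w => w *m N).
  have cN := @mulmxr_continuous R _ _ N.
  apply: DiffDef; first exact: (@linear_differentiable _ _ _ (mulmxr N)).
  exact: (@diff_lin _ _ _ (mulmxr N)).
rewrite (derive_comp v dF (@ex_diff _ _ _ _ _ _ _ dN)).
by rewrite (@diff_val _ _ _ _ _ _ _ dN).
Qed.

Lemma near_zero_small (V : normedModType R) (I : finType) (g : I -> V -> R) c e :
  0 < e -> (forall i, {for c, continuous (g i)}) -> (forall i, g i c = 0) ->
  \forall p \near c, forall i, `|g i p| <= e.
Proof.
move=> e0 cg gc; apply: filter_forall => i.
have := cg i => /cvgrPdist_le/(_ e e0); apply: filterS => p.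
by rewrite gc sub0r normrN.
Qed.

(** After normalisation by the inverse Jacobian at [c], the map [H] has identity differential there.
    Hence [K = id - H] has zero differential at [c] and is Lipschitz with constant 1/2 on a small
    ball. *)
Theorem inverse_function n (D : set 'rV[R]_n) (F : 'rV[R]_n -> 'rV[R]_n) c :
  open D -> D c -> smooth_on D F ->
  (forall p, D p -> \det ('J F p) != 0) ->
  exists r G, [/\ 0 < r, ball c r `<=` D, open (F @` ball c r),
    forall p, ball c r p -> G (F p) = p & smooth_on (F @` ball c r) G].
Proof.
move=> oD Dc sF J0.
have dF p : D p -> differentiable F p by move=> Dp; exact: smooth_differentiable sF Dp.
pose N := invmx ('J F c).
have uN : 'J F c \in unitmx by rewrite unitmxE unitfE J0.
pose H p := F p *m N.
pose K (p : 'rV[R]_n) : 'rV[R]_n := p + (-1) *: H p.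
have sH : smooth_on D H.
  by apply: (smooth_comp oD openT _ sF (smooth_mulmxr N)).
have sK j : smooth_on D (fun p => K p 0 j).
  apply: (smooth_eq_on_open oD _ (smooth_add oD
    (smooth_sub (@subsetT _ _) (smooth_entry R j))
    (smooth_opp oD ((smooth_coord _ oD).1 sH j)))) => p _.
  by rewrite /K !mxE mulN1r.
have dK i j : 'D_(delta_mx 0 i) (fun p => K p 0 j) c = 0.
  have dH := smooth_differentiable sH Dc.
  have dK : derivable K c (delta_mx 0 i).
    by apply: derivableD; [exact: derivable_id|apply: derivableZ; exact: diff_derivable].
  have /matrixP/(_ 0 j) := derive_mx dK; rewrite mxE => <-.
  rewrite deriveD ?derive_id; [|exact: derivable_id|].
    2: by apply: derivableZ; exact: diff_derivable.
  rewrite deriveZ; last exact: diff_derivable.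
  rewrite (derive_mulmxr _ _ (dF c Dc)) (deriveEjacobian _ (dF c Dc)).
  by rewrite -mulmxA mulmxV// mulmx1 scaleN1r subrr mxE.
(* Chosen so that [n * e <= 1/2] with the factor [n] of [mean_value_row]; the successor avoids a
   zero denominator for [n = 0]. *)
pose e : R := (2 * n.+1%:R)^-1.
have e0 : 0 < e by rewrite invr_gt0 mulr_gt0.
have Kn : \forall p \near c, D p /\
    forall ij : ('I_n * 'I_n)%type, `|'D_(delta_mx 0 ij.1) (fun q => K q 0 ij.2) p| <= e.
  apply: filterI; first exact: open_nbhs_nbhs.
  apply: (near_zero_small (g := fun (ij : ('I_n * 'I_n)%type) p =>
    'D_(delta_mx 0 ij.1) (fun q => K q 0 ij.2) p) e0) => -[i j]; last exact: dK.
  exact: smooth_continuous (smooth_derive _ (sK j)) Dc.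
have /nbhs_ballP[r /= r0 rP] := Kn.
have rD : ball c r `<=` D by move=> p /rP[].
have Hid p p' : ball c r p -> ball c r p' ->
    `|(p - p') - (H p - H p')| <= 2^-1 * `|p - p'|.
  move=> Bp Bp'; rewrite (_ : _ - _ = K p - K p'); last first.
    by rewrite /K !scaleN1r; apply/rowP => j; rewrite !mxE; ring.
  apply: row_norm_le => [|j]; first by rewrite mulr_ge0.
  rewrite [(K p - K p') 0 j]mxE [(- K p') 0 j]mxE.
  have := @mean_value_row R n c r (fun q => K q 0 j) e _ _ p p' Bp Bp'.
  rewrite /= => /(_ _ _)/le_trans ->//.
  - by move=> q /rD Dq; exact: smooth_differentiable (sK j) Dq.
  - by move=> q i /rP[_ /(_ (i, j))].
  rewrite ler_wpM2r// /e invfM mulrCA ler_piMr//.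
  by rewrite ler_pdivrMr// mul1r ler_nat.
have [k k0 Nk] := mulmx_bound N.
(* Half of the distance of [p] and [p'] is absorbed by [Hid], whence the factor 2; [k] bounds the
   passage from [F] to [H]. Injectivity of [F] on the ball follows. *)
have FL p p' : ball c r p -> ball c r p' -> `|p' - p| <= (2 * k) * `|F p' - F p|.
  move=> Bp Bp'; have := Hid p' p Bp' Bp.
  have := Nk (F p' - F p); rewrite mulmxBl -/(H p') -/(H p).
  have := ler_normD (H p' - H p) ((p' - p) - (H p' - H p)).
  by rewrite addrCA subrr addr0; lra.
(* Outside the image of the ball, [G] takes the arbitrary value [c]. *)
pose G y := xget c [set p | ball c r p /\ F p = y].
have GF p : ball c r p -> G (F p) = p.
  move=> Bp; rewrite /G; case: xgetP => [q _ [Bq FqFp]|/(_ p)[]//].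
  have := FL p q Bp Bq; rewrite FqFp subrr normr0 mulr0 normr_le0 subr_eq0.
  by move/eqP.
have oFB : open (F @` ball c r).
  have oH := near_identity_open_image Hid.
  rewrite (_ : F @` _ = (fun y => y *m N) @^-1` (H @` ball c r)).
    by apply: open_comp => // y _; exact: mulmxr_continuous.
  apply/seteqP; split=> [_ [p Bp <-]|y [p Bp]]; first by exists p.
  move=> /(congr1 (fun w => w *m 'J F c)); rewrite /H -!mulmxA mulVmx// !mulmx1.
  by move=> <-; exists p.
exists r, G; split=> //.
apply: inverse_smooth => //.
- exact: ball_open.
- exact: smooth_sub rD sF.
- by move=> p /rD/J0.
move=> p Bp.
apply: (inverse_is_diff (k := 2 * k) _ oFB Bp GF) => //.
- by rewrite mulr_gt0.
- by move=> p' Bp'; exact: FL.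
- exact/dF/rD.
- exact/J0/rD.
Qed.

End InverseFunction.
(** * Integration in the plane *)

(** Both difference quotients are the same function of the increment, so differentiability of [f] is
    not presupposed; [is_diff_of_partials] relies on this. *)
Lemma is_derive_line (R : realType) (V W : normedModType R) (f : V -> W)
    (e q : V) (t : R) l :
  is_derive t 1 (fun t => f (t *: e + q)) l <-> is_derive (t *: e + q) e f l.
Proof.
have E : (fun k : R => k^-1 *:
      (((fun t => f (t *: e + q)) \o shift t) (k *: 1) - f (t *: e + q))) =
    (fun k => k^-1 *: ((f \o shift (t *: e + q)) (k *: e) - f (t *: e + q))).
  apply/funext => k /=; congr (_ *: (f _ - _)).
  by rewrite [k *: (1 : R)]mulr1 scalerDl addrA.
by split=> -[]; [rewrite /derivable /derive E|rewrite /derivable /derive -E];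
  exact: DeriveDef.
Qed.

Section Plane.
Variable R : realType.
Implicit Types (s t r : R) (p q c : 'rV[R]_2) (D : set 'rV[R]_2).

(** Written on the basis vectors so that freezing one entry gives a line of the form treated by
    [is_derive_line]. *)
Definition row2 s t : 'rV[R]_2 := s *: delta_mx 0 0 + t *: delta_mx 0 1.

Lemma row2_0 s t : row2 s t 0 0 = s.
Proof. by rewrite !mxE/= mulr1 mulr0 addr0. Qed.

Lemma row2_1 s t : row2 s t 0 1 = t.
Proof. by rewrite !mxE/= mulr1 mulr0 add0r. Qed.

Lemma ord2_lift : lift ord0 ord0 = 1 :> 'I_2.
Proof. exact/val_inj. Qed.

Lemma ord2 (j : 'I_2) : j = 0 \/ j = 1.
Proof. by case: j => -[|[|//]] ?; [left|right]; apply/val_inj. Qed.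

Lemma row2_coord p : row2 (p 0 0) (p 0 1) = p.
Proof. by apply/rowP => j; have [->|->] := ord2 j; rewrite (row2_0, row2_1). Qed.

Lemma row2_box c s t r : 0 <= r ->
  `|s - c 0 0| <= r -> `|t - c 0 1| <= r -> `|row2 s t - c| <= r.
Proof.
move=> r0 sc tc; apply: row_norm_le => // j.
have [->|->] := ord2 j.
- by rewrite [X in `|X|]mxE row2_0 [X in _ + X]mxE.
- by rewrite [X in `|X|]mxE row2_1 [X in _ + X]mxE.
Qed.

Lemma is_derive_slice0 (h : 'rV[R]_2 -> R) s t l :
  is_derive s 1 (fun s => h (row2 s t)) l <->
  is_derive (row2 s t) (delta_mx 0 0) h l.
Proof. exact: is_derive_line. Qed.

Lemma is_derive_slice1 (h : 'rV[R]_2 -> R) s t l :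
  is_derive t 1 (fun t => h (row2 s t)) l <->
  is_derive (row2 s t) (delta_mx 0 1) h l.
Proof.
rewrite /row2 (addrC (s *: _)); under eq_fun do rewrite (addrC (s *: _)).
exact: is_derive_line.
Qed.

Lemma continuous_slice0 (W : topologicalType) (h : 'rV[R]_2 -> W) s t :
  {for row2 s t, continuous h} -> {for s, continuous (fun s => h (row2 s t))}.
Proof.
move=> ch; apply: (@continuous_comp _ _ _ (fun s => row2 s t)) => //.
by apply: cvgD; [exact: cvgZr_tmp|exact: cvg_cst].
Qed.

Lemma continuous_slice1 (W : topologicalType) (h : 'rV[R]_2 -> W) s t :
  {for row2 s t, continuous h} -> {for t, continuous (fun t => h (row2 s t))}.
Proof.
move=> ch; apply: (@continuous_comp _ _ _ (fun t => row2 s t)) => //.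
by apply: cvgD; [exact: cvg_cst|exact: cvgZr_tmp].
Qed.

Lemma integrable_of_continuous (g : R -> R) (a b : R) :
  (forall t, a <= t <= b -> {for t, continuous g}) ->
  (@lebesgue_measure R).-integrable `[a, b] (EFin \o g).
Proof.
move=> cg; apply: continuous_compact_integrable; first exact: segment_compact.
by apply: continuous_in_subspaceT => t /set_mem/=; rewrite in_itv/= => /cg.
Qed.

Lemma is_derive_integral (g : R -> R) (a b t : R) : a < t < b ->
  (forall t, a <= t <= b -> {for t, continuous g}) ->
  is_derive t 1 (fun y : R => \int[lebesgue_measure]_(x in `[a, y]) g x) (g t).
Proof.
move=> /andP[at_ tb] cg.
have ct : {for t, continuous g} by apply: cg; rewrite !ltW.
have [dF Fg] := continuous_FTC1_closed tb (integrable_of_continuous cg) at_ ct.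
by apply: DeriveDef; [exact: dF|rewrite -derive1E; exact: Fg].
Qed.

Lemma integral_derive (g dg : R -> R) (a b : R) : a < b ->
  (forall t, a <= t <= b -> is_derive t 1 g (dg t)) ->
  (forall t, a <= t <= b -> {for t, continuous dg}) ->
  \int[lebesgue_measure]_(x in `[a, b]) dg x = g b - g a.
Proof.
move=> ab gdg cdg; rewrite /Rintegral (@continuous_FTC2 R dg g)//.
- by apply: continuous_in_subspaceT => t /set_mem/=; rewrite in_itv/= => /cdg.
- have cg t : a <= t <= b -> {for t, continuous g}.
    by move=> /gdg[/derivable1_diffP/differentiable_continuous].
  split.
  + by move=> t; rewrite in_itv/= => /andP[a_t tb]; have [] := gdg t _; rewrite ?ltW.
  + by apply: cvg_at_right_filter; apply: cg; rewrite lexx ltW.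
  + by apply: cvg_at_left_filter; apply: cg; rewrite lexx ltW.
- move=> t; rewrite in_itv/= => /andP[a_t tb].
  by rewrite derive1E; have [] := gdg t _; rewrite ?ltW.
Qed.

Lemma continuous_norm (V W : normedModType R) (f : V -> W) v :
  {for v, continuous f} -> {for v, continuous (fun w => `|f w|)}.
Proof. exact: cvg_norm. Qed.

(** Domination is by a constant: the maximum [M] of the partial derivative on the compact box around
    [c]. *)
Lemma is_derive_under_integral D (h : 'rV[R]_2 -> R) c r s t : 0 < r ->
  open D -> (forall p, `|p - c| <= r -> D p) -> smooth_on D h ->
  `|s - c 0 0| < r -> c 0 1 - r <= t <= c 0 1 + r ->
  is_derive s 1 (fun s => \int[lebesgue_measure]_(y in `[c 0 1 - r, t]) h (row2 s y))
    (\int[lebesgue_measure]_(y in `[c 0 1 - r, t]) 'D_(delta_mx 0 0) h (row2 s y)).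
Proof.
move=> r0 oD cD sh sc /andP[tc0 tc1].
have sdh := smooth_derive (delta_mx 0 0) sh.
have Dst s' y : `|s' - c 0 0| <= r -> y \in `[c 0 1 - r, t] -> D (row2 s' y).
  rewrite in_itv/= => s'c /andP[y0 y1]; apply: cD; apply: row2_box => //.
    exact: ltW.
  by rewrite ler_distl y0 (le_trans y1).
have dh s' y : `|s' - c 0 0| <= r -> y \in `[c 0 1 - r, t] ->
    is_derive s' 1 (fun s => h (row2 s y)) ('D_(delta_mx 0 0) h (row2 s' y)).
  move=> s'c yI; apply/is_derive_slice0/derivableP; apply: diff_derivable.
  exact: smooth_differentiable sh (Dst _ _ s'c yI).
have [M M0 hM] : exists2 M, 0 <= M &
    forall p, `|p - c| <= r -> `|'D_(delta_mx 0 0) h p| <= M.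
  have cdh : {within [set p | `|p - c| <= r],
      continuous (fun p => `|'D_(delta_mx 0 0) h p|)}.
    apply: continuous_in_subspaceT => p /set_mem/cD Dp.
    exact: continuous_norm (smooth_continuous sdh Dp).
  have [|m _ mM] := EVT_max_rV _ (compact_row_box (ltW r0)) cdh.
    by exists c; rewrite /= subrr normr0 ltW.
  by exists `|'D_(delta_mx 0 0) h m| => // p pc; apply: mM; exact/mem_set.
have sI : `]c 0 0 - r, c 0 0 + r[%classic s by rewrite /= in_itv/= -ltr_distl.
have in_I s' : `]c 0 0 - r, c 0 0 + r[%classic s' -> `|s' - c 0 0| <= r.
  by rewrite /= in_itv/= -ltr_distl => /ltW.
have H : [/\ measurable (`[c 0 1 - r, t]%classic : set (measurableTypeR R)),
    forall s', `]c 0 0 - r, c 0 0 + r[%classic s' ->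
      (@lebesgue_measure R).-integrable `[c 0 1 - r, t]
        (EFin \o (fun y => h (row2 s' y))),
    forall s' y, `]c 0 0 - r, c 0 0 + r[%classic s' -> `[c 0 1 - r, t]%classic y ->
      derivable (fun s => h (row2 s y)) s' 1,
    (@lebesgue_measure R).-integrable `[c 0 1 - r, t] (EFin \o (fun=> M)) &
    forall s' y, `]c 0 0 - r, c 0 0 + r[%classic s' -> `[c 0 1 - r, t]%classic y ->
      `|partial1of2 (fun s y => h (row2 s y)) s' y| <= M].
  split.
  - exact: measurable_itv.
  - move=> s' /in_I s'c; apply: integrable_of_continuous => y yI.
    by apply: continuous_slice1; apply: smooth_continuous sh _; exact: Dst.
  - by move=> s' y /in_I s'c yI; have [] := dh s' y s'c yI.
  - by apply: integrable_of_continuous => y _; exact: cvg_cst.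
  - move=> s' y /in_I s'c yI; rewrite partial1of2E; have [_ ->] := dh s' y s'c yI.
    apply: hM; apply: row2_box => //; first exact: ltW.
    move: yI; rewrite /= in_itv/= => /andP[y0 y1].
    by rewrite ler_distl y0 (le_trans y1).
have [mI ih dhI iM hMI] := H.
apply: DeriveDef.
  exact: (derivable_under_integral mI sI ih dhI (fun=> M0) iM hMI).
rewrite -derive1E (differentiation_under_integral mI sI ih dhI (fun=> M0) iM hMI).
apply: eq_Rintegral => y /set_mem yI; rewrite partial1of2E.
by have [_ ->] := dh s y (ltW sc) yI.
Qed.

End Plane.

(** * Symmetry of second derivatives and the Poincare lemma in the plane *)

Section PoincareLemma.
Variable R : realType.
Implicit Types (s t r : R) (p q c : 'rV[R]_2) (D : set 'rV[R]_2).

Lemma near_dist (a r : R) : 0 < r -> \forall s \near a, `|s - a| < r.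
Proof.
by move=> r0; apply/nbhs_ballP; exists r => // s; rewrite /ball/= distrC.
Qed.

(** The integral of ['D_1 g] along a vertical segment is an increment of [g]. Differentiating it
    horizontally under the integral sign, and then with respect to the upper end, yields both mixed
    derivatives. *)
Lemma derive_symmetric D (g : 'rV[R]_2 -> R) p : open D -> D p ->
  smooth_on D g ->
  'D_(delta_mx 0 0) ('D_(delta_mx 0 1) g) p = 'D_(delta_mx 0 1) ('D_(delta_mx 0 0) g) p.
Proof.
move=> oD Dp sg.
have /nbhs_ballP[r2 /= r20 r2D] : nbhs p D by apply: open_nbhs_nbhs.
pose r := r2 / 2.
have r0 : 0 < r by rewrite divr_gt0.
have pD q : `|q - p| <= r -> D q.
  move=> qp; apply: r2D; rewrite -ball_normE/= distrC.
  by rewrite (le_lt_trans qp)// /r ltr_pdivrMr// ltr_pMr// ltr1n.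
have s0 := smooth_derive (delta_mx 0 0) sg.
have s1 := smooth_derive (delta_mx 0 1) sg.
have s01 := smooth_derive (delta_mx 0 0) s1.
pose y0 := p 0 1 - r; pose y1 := p 0 1 + r.
have y01 : y0 < p 0 1 < y1 by rewrite ltrBlDr ltrDl r0.
have Dst s y : `|s - p 0 0| <= r -> y0 <= y <= y1 -> D (row2 s y).
  by move=> sp yI; apply: pD; apply: (row2_box (ltW r0) sp); rewrite ler_distl.
have spE : `|p 0 0 - p 0 0| < r by rewrite subrr normr0.
pose G t s := \int[lebesgue_measure]_(y in `[y0, t]) 'D_(delta_mx 0 1) g (row2 s y).
have GE t s : `|s - p 0 0| <= r -> y0 < t <= y1 ->
    G t s = g (row2 s t) - g (row2 s y0).
  move=> sp /andP[t0 t1].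
  apply: (integral_derive (g := fun y => g (row2 s y)) t0) => y /andP[yt0 yt1].
    apply/is_derive_slice1/derivableP; apply: diff_derivable.
    by apply: smooth_differentiable sg _; apply: Dst; rewrite // yt0 (le_trans yt1).
  have Dsy : D (row2 s y) by apply: Dst; rewrite // yt0 (le_trans yt1).
  exact: (@continuous_slice1 R R _ s y (smooth_continuous s1 Dsy)).
have GD t : y0 < t < y1 ->
    \int[lebesgue_measure]_(y in `[y0, t])
      'D_(delta_mx 0 0) ('D_(delta_mx 0 1) g) (row2 (p 0 0) y) =
    'D_(delta_mx 0 0) g (row2 (p 0 0) t) - 'D_(delta_mx 0 0) g (row2 (p 0 0) y0).
  move=> /andP[t0 t1].
  have tI : y0 <= t <= y1 by rewrite !ltW.
  have [_ <-] := is_derive_under_integral r0 oD pD s1 spE tI.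
  have E : \forall s \near p 0 0, G t s = g (row2 s t) - g (row2 s y0).
    near=> s; apply: GE; last by rewrite t0 ltW.
    by apply: ltW; near: s; exact: near_dist.
  rewrite -/(G t) (near_eq_derive _ E).
  have d0 y : y0 <= y <= y1 -> derivable g (row2 (p 0 0) y) (delta_mx 0 0).
    move=> yI; apply: diff_derivable; apply: smooth_differentiable sg _.
    by apply: Dst; rewrite // ltW.
  have /is_derive_slice0 d1 := derivableP (d0 _ tI).
  have d2 : is_derive (p 0 0) 1 (fun s => g (row2 s y0))
      ('D_(delta_mx 0 0) g (row2 (p 0 0) y0)).
    apply/is_derive_slice0/derivableP; apply: d0.
    by rewrite lexx (le_trans _ (ltW t1)) ?ltW.
  by have [d1' <-] := d1; have [d2' <-] := d2; rewrite (deriveB d1' d2').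
have [_] := @is_derive_integral _
  (fun y => 'D_(delta_mx 0 0) ('D_(delta_mx 0 1) g) (row2 (p 0 0) y)) _ _ _ y01
  (fun y yI => continuous_slice1 (smooth_continuous s01 (Dst _ _ (ltW spE) yI))).
rewrite row2_coord => <-.
have E : \forall t \near p 0 1, \int[lebesgue_measure]_(y in `[y0, t])
      'D_(delta_mx 0 0) ('D_(delta_mx 0 1) g) (row2 (p 0 0) y) =
    'D_(delta_mx 0 0) g (row2 (p 0 0) t) - 'D_(delta_mx 0 0) g (row2 (p 0 0) y0).
  near=> t; apply: GD; near: t.
  by under eq_near do rewrite -ltr_distl; exact: near_dist.
have H : is_derive (row2 (p 0 0) (p 0 1)) (delta_mx 0 1) ('D_(delta_mx 0 0) g)
    ('D_(delta_mx 0 1) ('D_(delta_mx 0 0) g) p).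
  rewrite row2_coord; apply: derivableP; apply: diff_derivable.
  exact: smooth_differentiable s0 Dp.
have [d10 d10E] := (is_derive_slice1 _ _ _ _).2 H.
rewrite (near_eq_derive _ E).
rewrite (deriveB d10 (derivable_cst ('D_(delta_mx 0 0) g (row2 (p 0 0) y0)) _ _)).
by rewrite d10E derive_cst subr0.
Unshelve. all: by end_near. Qed.

(** The mean value theorem in the parameter [t] of [0, 1], which treats both signs of [tau] at
    once. *)
Lemma increment_estimate (V : normedModType R) (f g : V -> R) (q e : V) (tau l eps : R) :
  (forall t, 0 <= t <= 1 ->
    is_derive ((t * tau) *: e + q) e f (g ((t * tau) *: e + q)) /\
    `|g ((t * tau) *: e + q) - l| <= eps) ->
  `|f (tau *: e + q) - f q - l * tau| <= eps * `|tau|.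
Proof.
move=> fg; pose phi (t : R) := f ((t * tau) *: e + q).
have dphi (t : R) : 0 <= t <= 1 ->
    is_derive t 1 phi (tau * g ((t * tau) *: e + q)).
  move=> /fg[/is_derive_line df _].
  have dm : is_derive t 1 (fun t : R => t * tau) tau.
    by apply: is_derive_eq; rewrite /GRing.scale/= ?mulr0 ?mulr1 ?addr0 ?add0r.
  have := @is_derive1_comp R (fun t => f (t *: e + q)) (fun t => t * tau) t _ _ df dm.
  by rewrite mulrC.
have dphi' (t : R) : t \in `]0, 1[ ->
    is_derive t 1 phi (tau * g ((t * tau) *: e + q)).
  by rewrite in_itv/= => /andP[t0 t1]; apply: dphi; rewrite !ltW.
have cphi : {within `[0, 1], continuous phi}.
  apply: derivable_within_continuous => t; rewrite in_itv/= => /dphi.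
  by move=> [].
have [t] := MVT_segment ler01 dphi' cphi.
rewrite in_itv/= => t01; rewrite /phi mul1r mul0r scale0r add0r subr0 mulr1 => ->.
rewrite mulrC -mulrBl normrM.
by rewrite ler_wpM2r//; have [] := fg t t01.
Qed.

(** The increment from [p] to [h + p] is split at the corner [p1] into two axis-parallel steps, each
    estimated by one partial derivative with error [e / 2]. *)
Lemma is_diff_of_partials D (f a b : 'rV[R]_2 -> R) p : open D -> D p ->
  (forall q, D q -> is_derive q (delta_mx 0 0) f (a q)) ->
  (forall q, D q -> is_derive q (delta_mx 0 1) f (b q)) ->
  {for p, continuous a} -> {for p, continuous b} ->
  is_diff p f (fun h => h 0 0 * a p + h 0 1 * b p).
Proof.
move=> oD Dp fa fb ca cb.
pose L (h : 'rV[R]_2) : R := h 0 0 * a p + h 0 1 * b p.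
have linL : linear L by move=> k u v; rewrite /L !mxE /GRing.scale/=; ring.
pose LM := GRing.isLinear.Build _ _ _ _ _ linL.
pose LL : {linear _ -> _} := HB.pack L LM.
have sL : smooth_on setT L.
  apply: (smooth_add openT); apply: (smooth_mul openT);
    (exact: smooth_entry || exact: (smooth_cst (W := R))).
have near_p (g : 'rV[R]_2 -> R) e : {for p, continuous g} -> 0 < e ->
    exists2 d, 0 < d & forall q, ball p d q -> `|g q - g p| <= e.
  move=> cg e0; have /nbhs_ballP[d d0 dP] : \forall q \near p, `|g q - g p| <= e.
    by near do rewrite distrC; exact: cvgr_dist_le.
  by exists d.
apply: (@linear_approx_is_diff R _ _ f p LL).
  by move=> h; exact: smooth_continuous sL _.
move=> e e0; have e20 : 0 < e / 2 by rewrite divr_gt0.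
have [da da0 aP] := near_p a _ ca e20.
have [db db0 bP] := near_p b _ cb e20.
have /nbhs_ballP[d0 /= d00 DP] : nbhs p D by apply: open_nbhs_nbhs.
apply/nbhs_ballP; exists (Num.min d0 (Num.min da db)) => /=.
  by rewrite !lt_min d00 da0.
move=> h; rewrite -ball_normE/= sub0r normrN !lt_min => /and3P[h0 ha hb].
have hE : h = h 0 0 *: delta_mx 0 0 + h 0 1 *: delta_mx 0 1.
  by rewrite -[RHS]/(row2 _ _) row2_coord.
have small (u w : R) : `|u| <= `|h 0 0| -> `|w| <= `|h 0 1| ->
    `|u *: delta_mx 0 0 + w *: delta_mx 0 1 : 'rV[R]_2| <= `|h|.
  move=> uh wh; have := @row2_box R 0 u w `|h| (normr_ge0 h); rewrite !mxE !subr0.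
  by apply; [apply: (le_trans uh)|apply: (le_trans wh)]; exact: row_coord_le_norm.
have smallB (u w d : R) : `|u| <= `|h 0 0| -> `|w| <= `|h 0 1| -> `|h| < d ->
    ball p d (u *: delta_mx 0 0 + (w *: delta_mx 0 1 + p)).
  move=> uh wh hd; rewrite -ball_normE/= addrA opprD addrCA subrr addr0 normrN.
  by rewrite (le_lt_trans (small _ _ uh wh)).
have t_le (t u : R) : 0 <= t <= 1 -> `|t * u| <= `|u|.
  by move=> /andP[t0 t1]; rewrite normrM ger0_norm// ler_piMl.
pose p1 := h 0 1 *: delta_mx 0 1 + p.
have E0 : `|f (h 0 0 *: delta_mx 0 0 + p1) - f p1 - a p * h 0 0| <= e / 2 * `|h 0 0|.
  apply: (increment_estimate (g := a)) => t t01; split.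
    by apply: fa; apply: DP; apply: smallB => //; exact: t_le.
  by apply: aP; apply: smallB => //; exact: t_le.
have E1 : `|f p1 - f p - b p * h 0 1| <= e / 2 * `|h 0 1|.
  have F (t : R) : (t * h 0 1) *: delta_mx 0 1 + p =
     (0 : R) *: delta_mx 0 0 + ((t * h 0 1) *: delta_mx 0 1 + p) by rewrite scale0r add0r.
  apply: (increment_estimate (g := b)) => t t01; split.
    by apply: fb; apply: DP; rewrite F; apply: smallB; rewrite ?normr0//; exact: t_le.
  by apply: bP; rewrite F; apply: smallB; rewrite ?normr0//; exact: t_le.
have -> : f (h + p) - f p - LL h =
   (f (h 0 0 *: delta_mx 0 0 + p1) - f p1 - a p * h 0 0) + (f p1 - f p - b p * h 0 1).
  by rewrite [in f (_ + p1)]/p1 [in f (_ + (_ + p))]addrA -hE /= /L; ring.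
rewrite (le_trans (ler_normD _ _))//.
have := row_coord_le_norm h 0; have := row_coord_le_norm h 1.
move: E0 E1; set A := `|_ - a p * _|; set B := `|_ - b p * _| => E0 E1 h1 h0'.
have := ler_wpM2l (ltW e20) h1; have := ler_wpM2l (ltW e20) h0'.
lra.
Unshelve. all: by end_near. Qed.

(** The primitive integrates [a] along the bottom side of a square, then [b] upwards. Starting from
    the lower left corner keeps each upper limit above the lower one, and halving [r] puts the
    closed square inside the open ball. *)
Theorem poincare_lemma (a b : 'rV[R]_2 -> R) c r : 0 < r ->
  smooth_on (ball c r) a -> smooth_on (ball c r) b ->
  (forall p, ball c r p -> 'D_(delta_mx 0 1) a p = 'D_(delta_mx 0 0) b p) ->
  exists2 f : 'rV[R]_2 -> R, smooth_on (ball c (r / 2)) f &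
    forall p v, ball c (r / 2) p -> 'D_v f p = v 0 0 * a p + v 0 1 * b p.
Proof.
move=> r0 sa sb ab; pose k := r / 2; rewrite -/k.
have k0 : 0 < k by rewrite divr_gt0.
have oD : open (ball c r) by exact: ball_open.
have cD p : `|p - c| <= k -> ball c r p.
  move=> pc; rewrite -ball_normE/= distrC (le_lt_trans pc)//.
  by rewrite /k ltr_pdivrMr// ltr_pMr// ltr1n.
pose s0 := c 0 0 - k; pose t0 := c 0 1 - k.
have Dst s t : `|s - c 0 0| <= k -> `|t - c 0 1| <= k -> ball c r (row2 s t).
  by move=> sc tc; apply: cD; exact: row2_box (ltW k0) sc tc.
have t0c : `|t0 - c 0 1| <= k by rewrite /t0 addrC addKr normrN gtr0_norm.
pose f1 s := \int[lebesgue_measure]_(x in `[s0, s]) a (row2 x t0).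
pose f2 s t := \int[lebesgue_measure]_(y in `[t0, t]) b (row2 s y).
pose f (p : 'rV[R]_2) := f1 (p 0 0) + f2 (p 0 0) (p 0 1).
have fE s t : f (row2 s t) = f1 s + f2 s t by rewrite /f row2_0 row2_1.
have coordB p : ball c k p -> `|p 0 0 - c 0 0| < k /\ `|p 0 1 - c 0 1| < k.
  rewrite -ball_normE/= distrC => pc.
  by split; rewrite (le_lt_trans _ pc)//;
    [have := row_coord_le_norm (p - c) 0|have := row_coord_le_norm (p - c) 1];
    rewrite [X in `|X| <= _]mxE [X in `|_ + X| <= _]mxE.
have partial1 p : ball c k p -> is_derive p (delta_mx 0 1) f (b p).
  move=> /coordB[pc0 pc1]; rewrite -(row2_coord p); apply/is_derive_slice1.
  under eq_fun do rewrite fE.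
  have tI : t0 < p 0 1 < c 0 1 + k by rewrite -ltr_distl.
  have d2 : is_derive (p 0 1) 1 (f2 (p 0 0)) (b (row2 (p 0 0) (p 0 1))).
    apply: (is_derive_integral tI) => t /andP[tt0 tt1].
    have Dpt : ball c r (row2 (p 0 0) t).
      by apply: (Dst _ _ (ltW pc0)); rewrite ler_distl tt0.
    exact: (@continuous_slice1 R R _ _ t (smooth_continuous sb Dpt)).
  rewrite -[b _]add0r.
  exact: (is_deriveD (is_derive_cst _ _ _) d2).
have partial0 p : ball c k p -> is_derive p (delta_mx 0 0) f (a p).
  move=> /coordB[pc0 pc1]; rewrite -(row2_coord p); apply/is_derive_slice0.
  under eq_fun do rewrite fE.
  have sI : s0 < p 0 0 < c 0 0 + k by rewrite -ltr_distl.
  have d1 : is_derive (p 0 0) 1 f1 (a (row2 (p 0 0) t0)).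
    apply: (is_derive_integral (g := fun x => a (row2 x t0)) sI) => s /andP[ss0 ss1].
    have Dpt : ball c r (row2 s t0) by apply: (Dst _ _ _ t0c); rewrite ler_distl ss0.
    exact: (@continuous_slice0 R R _ s _ (smooth_continuous sa Dpt)).
  have tI : t0 <= p 0 1 <= c 0 1 + k by rewrite -ler_distl ltW.
  have d2 := is_derive_under_integral k0 oD cD sb pc0 tI.
  have /andP[tlt _] : t0 < p 0 1 < c 0 1 + k by rewrite -ltr_distl.
  have Dy y : t0 <= y <= p 0 1 -> ball c r (row2 (p 0 0) y).
    move=> /andP[y0 y1]; apply: Dst; first exact: ltW.
    by rewrite ler_distl y0 (le_trans y1)//; case/andP: tI.
  (* Closedness makes the integrand a vertical derivative of [a]; the boundary term at [t0] cancels
     the derivative of [f1]. *)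
  have E : \int[lebesgue_measure]_(y in `[t0, p 0 1]) 'D_(delta_mx 0 0) b (row2 (p 0 0) y)
      = a (row2 (p 0 0) (p 0 1)) - a (row2 (p 0 0) t0).
    have da (y : R) : t0 <= y <= p 0 1 -> is_derive y 1 (fun y => a (row2 (p 0 0) y))
        ('D_(delta_mx 0 1) a (row2 (p 0 0) y)).
      move=> yI; apply/is_derive_slice1/derivableP; apply: diff_derivable.
      exact: smooth_differentiable sa (Dy y yI).
    rewrite -(integral_derive tlt da); last first.
      move=> y yI; have sDa := smooth_derive (delta_mx 0 1) sa.
      exact: (@continuous_slice1 R R _ _ y (smooth_continuous sDa (Dy y yI))).
    apply: eq_Rintegral => y /set_mem/=; rewrite in_itv/= => yI.
    by rewrite ab//; exact: Dy.
  rewrite E in d2.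
  rewrite -[a (row2 (p 0 0) (p 0 1))](subrKC (a (row2 (p 0 0) t0))).
  exact: (is_deriveD d1 d2).
have kr : ball c k `<=` ball c r.
  by apply: le_ball; rewrite /k ler_pdivrMr// ler_pMr// ler1n.
have okB : open (ball c k) by exact: ball_open.
have df p : ball c k p -> is_diff p f (fun h => h 0 0 * a p + h 0 1 * b p).
  move=> Bp; apply: (is_diff_of_partials okB Bp partial0 partial1).
    exact: smooth_continuous sa (kr _ Bp).
  exact: smooth_continuous sb (kr _ Bp).
have Df p v : ball c k p -> 'D_v f p = v 0 0 * a p + v 0 1 * b p.
  move=> /df dfp; rewrite (deriveE _ (@ex_diff _ _ _ _ _ _ _ dfp)).
  by rewrite (@diff_val _ _ _ _ _ _ _ dfp).
exists f => //; apply: smooth_of_derive => [p /df dfp|v].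
  exact: (@ex_diff _ _ _ _ _ _ _ dfp).
apply: (smooth_eq_on_open okB (fun p Bp => esym (Df p v Bp))).
by apply: smooth_add => //; apply: smooth_mul => //;
  (exact: (smooth_cst (W := R)) || exact: smooth_sub kr _).
Qed.

End PoincareLemma.
(** * Flat coordinates *)

Section FlatCoordinates.
Variable R : realType.

Section DeriveRules.
Variables (V : normedModType R) (p v : V).
Implicit Types f g : V -> R.

Lemma is_derive_addf f g df dg : is_derive p v f df -> is_derive p v g dg ->
  is_derive p v (fun q => f q + g q) (df + dg).
Proof. exact: is_deriveD. Qed.

Lemma is_derive_mulf f g df dg : is_derive p v f df -> is_derive p v g dg ->
  is_derive p v (fun q => f q * g q) (f p * dg + g p * df).
Proof. exact: is_deriveM. Qed.

Lemma is_derive_scalef f (k df : R) : is_derive p v f df ->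
  is_derive p v (fun q => k * f q) (k * df).
Proof. exact: is_deriveZ. Qed.

Lemma is_derive_smooth (D : set V) f : D p -> smooth_on D f ->
  is_derive p v f ('D_v f p).
Proof.
by move=> Dp sf; apply: derivableP; apply: diff_derivable;
  exact: smooth_differentiable sf Dp.
Qed.

Lemma is_derive_sinf f : differentiable f p ->
  is_derive p v (fun q => sin (f q)) (cos (f p) * 'D_v f p).
Proof.
move=> df; have [d <-] := derive_comp1 v df (is_derive_sin (f p)).
by apply: derivableP; exact: diff_derivable.
Qed.

Lemma is_derive_cosf f : differentiable f p ->
  is_derive p v (fun q => cos (f q)) (- sin (f p) * 'D_v f p).
Proof.
move=> df; have [d <-] := derive_comp1 v df (is_derive_cos (f p)).
by apply: derivableP; exact: diff_derivable.
Qed.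

End DeriveRules.

Lemma derive_partials (g : 'rV[R]_2 -> R) p v : differentiable g p ->
  'D_v g p = v 0 0 * 'D_(delta_mx 0 0) g p + v 0 1 * 'D_(delta_mx 0 1) g p.
Proof.
move=> dg; rewrite deriveE// deriveErow// big_ord_recl big_ord1.
by rewrite ord2_lift.
Qed.

Lemma is_derive_oppf (V : normedModType R) (f : V -> R) p v df :
  is_derive p v f df -> is_derive p v (fun q => - f q) (- df).
Proof. exact: is_deriveN. Qed.

Section Forms.
Variables (c : 'rV[R]_2) (r : R) (r0 : 0 < r).
Let D := ball c r.
Variables (X1 X2 X3 psi : 'rV[R]_2 -> R) (C S : R).
Hypotheses (sX1 : smooth_on D X1) (sX2 : smooth_on D X2) (sX3 : smooth_on D X3).
Hypotheses (spsi : smooth_on D psi) (C0 : C != 0) (CS : S ^+ 2 = C ^+ 2 - 1).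
Hypothesis normal : forall p v, D p ->
  C * 'D_v X3 p = - S * (cos (psi p) * 'D_v X1 p + sin (psi p) * 'D_v X2 p).

Let oD : open D. Proof. exact: ball_open. Qed.

Let e0 : 'rV[R]_2 := delta_mx 0 0.
Let e1 : 'rV[R]_2 := delta_mx 0 1.

Lemma derive_normal p v w : D p ->
  C * 'D_w ('D_v X3) p = - S *
    (cos (psi p) * 'D_w ('D_v X1) p + 'D_v X1 p * (- sin (psi p) * 'D_w psi p) +
    (sin (psi p) * 'D_w ('D_v X2) p + 'D_v X2 p * (cos (psi p) * 'D_w psi p))).
Proof.
move=> Dp; have dpsi := smooth_differentiable spsi Dp.
have [_ <-] := is_derive_scalef C (is_derive_smooth w Dp (smooth_derive v sX3)).
rewrite (eq_on_open_derive (f := fun q => C * 'D_v X3 q) w oD Dp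
  (fun q Dq => normal v Dq)).
have := is_derive_scalef (- S) (is_derive_addf
  (is_derive_mulf (is_derive_cosf w dpsi) (is_derive_smooth w Dp (smooth_derive v sX1)))
  (is_derive_mulf (is_derive_sinf w dpsi) (is_derive_smooth w Dp (smooth_derive v sX2)))).
by case.
Qed.

(** This is [S dpsi /\ o = 0] in coordinates: antisymmetrising [derive_normal] removes all second
    derivatives. *)
Lemma dpsi_wedge p : D p ->
  S * (sin (psi p) * ('D_e1 psi p * 'D_e0 X1 p - 'D_e0 psi p * 'D_e1 X1 p) -
       cos (psi p) * ('D_e1 psi p * 'D_e0 X2 p - 'D_e0 psi p * 'D_e1 X2 p)) = 0.
Proof.
move=> Dp; have E01 := derive_normal e1 e0 Dp; have E10 := derive_normal e0 e1 Dp.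
rewrite (derive_symmetric oD Dp sX3) (derive_symmetric oD Dp sX1)
  (derive_symmetric oD Dp sX2) -/e0 -/e1 in E01.
rewrite -[RHS](subrr (C * 'D_e1 ('D_e0 X3) p)) {1}E10 E01.
move: (sin _) (cos _) ('D_e1 psi p) ('D_e0 psi p) ('D_e0 X1 p) ('D_e1 X1 p)
  ('D_e0 X2 p) ('D_e1 X2 p) ('D_e1 ('D_e0 X1) p) ('D_e1 ('D_e0 X2) p) => *.
ring.
Qed.

(* [(k, l)] will be the unit vector of angle [C * psi], and then that vector
   turned by a right angle. *)
Lemma rotated_form_exact (k l : 'rV[R]_2 -> R) :
  smooth_on D k -> smooth_on D l ->
  (forall p v, D p -> 'D_v k p = - (C * l p * 'D_v psi p)) ->
  (forall p v, D p -> 'D_v l p = C * k p * 'D_v psi p) ->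
  exists2 f : 'rV[R]_2 -> R, smooth_on (ball c (r / 2)) f &
  forall p v, ball c (r / 2) p -> 'D_v f p =
    (k p * cos (psi p) / C + l p * sin (psi p)) * 'D_v X1 p +
    (k p * sin (psi p) / C - l p * cos (psi p)) * 'D_v X2 p.
Proof.
move=> sk sl dk dl.
have [ssin scos] := smooth_sin_cos oD spsi.
(* [A dX1 + B dX2] is the form [k e - l o]. *)
pose A p := C^-1 * (k p * cos (psi p)) + l p * sin (psi p).
pose B p := C^-1 * (k p * sin (psi p)) + -1 * (l p * cos (psi p)).
have scst (x : R) : smooth_on D (fun=> x) by exact: (smooth_cst (W := R)).
have sA : smooth_on D A.
  by apply: (smooth_add oD); do ?apply: (smooth_mul oD).
have sB : smooth_on D B.
  by apply: (smooth_add oD); do ?apply: (smooth_mul oD).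
(* The terms in [l] cancel because [(k, l)] turns exactly [C] times as fast as [psi]. *)
have dA p v : D p -> is_derive p v A ((C - C^-1) * k p * sin (psi p) * 'D_v psi p).
  move=> Dp; have dpsi := smooth_differentiable spsi Dp.
  have dkp := is_derive_smooth v Dp sk; have dlp := is_derive_smooth v Dp sl.
  have := is_derive_addf
    (is_derive_scalef C^-1 (is_derive_mulf dkp (is_derive_cosf v dpsi)))
    (is_derive_mulf dlp (is_derive_sinf v dpsi)).
  move=> H; apply: (is_derive_eq H); rewrite (dk _ _ Dp) (dl _ _ Dp).
  by move: (k p) (l p) (sin _) (cos _) ('D_v psi p) => *; field.
have dB p v : D p -> is_derive p v B (- ((C - C^-1) * k p * cos (psi p) * 'D_v psi p)).
  move=> Dp; have dpsi := smooth_differentiable spsi Dp.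
  have dkp := is_derive_smooth v Dp sk; have dlp := is_derive_smooth v Dp sl.
  have := is_derive_addf
    (is_derive_scalef C^-1 (is_derive_mulf dkp (is_derive_sinf v dpsi)))
    (is_derive_scalef (-1) (is_derive_mulf dlp (is_derive_cosf v dpsi))).
  move=> H; apply: (is_derive_eq H); rewrite (dk _ _ Dp) (dl _ _ Dp).
  by move: (k p) (l p) (sin _) (cos _) ('D_v psi p) => *; field.
pose a e p := A p * 'D_e X1 p + B p * 'D_e X2 p.
have sa e : smooth_on D (a e).
  by apply: (smooth_add oD); apply: (smooth_mul oD) => //; exact: smooth_derive.
have da p v e : D p -> 'D_v (a e) p =
    A p * 'D_v ('D_e X1) p + 'D_e X1 p * ((C - C^-1) * k p * sin (psi p) * 'D_v psi p) +
    (B p * 'D_v ('D_e X2) p - 'D_e X2 p * ((C - C^-1) * k p * cos (psi p) * 'D_v psi p)).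
  move=> Dp; rewrite -mulrN.
  by have [] := is_derive_addf
    (is_derive_mulf (dA p v Dp) (is_derive_smooth v Dp (smooth_derive e sX1)))
    (is_derive_mulf (dB p v Dp) (is_derive_smooth v Dp (smooth_derive e sX2))).
have closed p : D p -> 'D_e1 (a e0) p = 'D_e0 (a e1) p.
  move=> Dp; rewrite (da _ _ _ Dp) (da _ _ _ Dp).
  rewrite (derive_symmetric oD Dp sX1) (derive_symmetric oD Dp sX2) -/e0 -/e1.
  apply/eqP; rewrite -subr_eq0; apply/eqP.
  (* One factor [S] is consumed by [dpsi_wedge], so [S] is never inverted. *)
  have -> : C - C^-1 = S * S / C.
    by rewrite -expr2 CS; field.
  transitivity (S * k p / C * (S *
      (sin (psi p) * ('D_e1 psi p * 'D_e0 X1 p - 'D_e0 psi p * 'D_e1 X1 p) -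
       cos (psi p) * ('D_e1 psi p * 'D_e0 X2 p - 'D_e0 psi p * 'D_e1 X2 p)))).
    move: (A p) (B p) (k p) (sin _) (cos _) ('D_e1 psi p) ('D_e0 psi p) ('D_e0 X1 p)
      ('D_e1 X1 p) ('D_e0 X2 p) ('D_e1 X2 p) ('D_e1 ('D_e0 X1) p)
      ('D_e1 ('D_e0 X2) p) => *.
    by field.
  by rewrite (dpsi_wedge Dp) mulr0.
have [f sf df] := poincare_lemma r0 (sa e0) (sa e1) closed.
exists f; first exact: sf.
move=> p v Bp; rewrite (df _ _ Bp).
have Dp : D p by apply: le_ball Bp; rewrite ler_pdivrMr// ler_pMr// ler1n.
rewrite (derive_partials v (smooth_differentiable sX1 Dp)).
rewrite (derive_partials v (smooth_differentiable sX2 Dp)) /a /A /B -/e0 -/e1.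
move: (k p) (l p) (sin _) (cos _) ('D_e0 X1 p) ('D_e1 X1 p) ('D_e0 X2 p) ('D_e1 X2 p)
  (v 0 0) (v 0 1) => *.
by field.
Qed.

(* Used with [x, y, z] the derivatives of [X1, X2, X3] along [v], [x', y', z']
   those along [w], and [(cs, sn)], [(k, l)] the unit vectors of angles [psi]
   and [C * psi]. *)
Lemma rotated_frame_metric (x y z x' y' z' cs sn k l : R) :
  cs ^+ 2 + sn ^+ 2 = 1 -> k ^+ 2 + l ^+ 2 = 1 ->
  C * z = - S * (cs * x + sn * y) -> C * z' = - S * (cs * x' + sn * y') ->
  ((k * cs / C + l * sn) * x + (k * sn / C - l * cs) * y) *
  ((k * cs / C + l * sn) * x' + (k * sn / C - l * cs) * y') +
  ((l * cs / C - k * sn) * x + (l * sn / C + k * cs) * y) *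
  ((l * cs / C - k * sn) * x' + (l * sn / C + k * cs) * y') =
  x * x' + y * y' - z * z'.
Proof.
move=> cs1 kl1 zE z'E.
have -> : z = - S * (cs * x + sn * y) / C by rewrite -zE mulrC mulKf.
have -> : z' = - S * (cs * x' + sn * y') / C by rewrite -z'E mulrC mulKf.
(* Here [e] lacks the divisor [C]: the two rotated forms are [k e / C - l o] and [l e / C + k o]. *)
pose e := cs * x + sn * y; pose o := cs * y - sn * x.
pose e' := cs * x' + sn * y'; pose o' := cs * y' - sn * x'.
transitivity ((k ^+ 2 + l ^+ 2) * (e * e' / C ^+ 2 + o * o')).
  by rewrite /e /e' /o /o'; field.
(* This uses [1 / C^2 = 1 - S^2 / C^2]; the subtracted term is [z * z']. *)
transitivity ((e * e' + o * o') - S ^+ 2 * (e * e') / C ^+ 2).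
  by rewrite CS kl1; field.
have -> : e * e' + o * o' = (cs ^+ 2 + sn ^+ 2) * (x * x' + y * y').
  by rewrite /e /e' /o /o'; ring.
by rewrite cs1 /e /e'; field.
Qed.

(** With [phi = C psi], the differentials are [cos phi e - sin phi o] and [sin phi e + cos phi o].
    The second comes from the pair [(sin phi, - cos phi)], which obeys the same differential
    equations as [(cos phi, sin phi)]. *)
Lemma flat_coordinates : exists f1 f2 : 'rV[R]_2 -> R,
  [/\ smooth_on (ball c (r / 2)) f1, smooth_on (ball c (r / 2)) f2 &
  forall p v w, ball c (r / 2) p ->
    'D_v f1 p * 'D_w f1 p + 'D_v f2 p * 'D_w f2 p =
    'D_v X1 p * 'D_w X1 p + 'D_v X2 p * 'D_w X2 p - 'D_v X3 p * 'D_w X3 p].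
Proof.
pose phi p := C * psi p.
have sphi : smooth_on D phi by exact: smooth_mul oD (smooth_cst (W := R) D C) spsi.
have [ssin scos] := smooth_sin_cos oD sphi.
have dphi p v : D p -> 'D_v phi p = C * 'D_v psi p.
  by move=> Dp; have [] := is_derive_scalef C (is_derive_smooth v Dp spsi).
have dcos p v : D p -> 'D_v (fun q => cos (phi q)) p = - (C * sin (phi p) * 'D_v psi p).
  move=> Dp; have [_ ->] := is_derive_cosf v (smooth_differentiable sphi Dp).
  by rewrite (dphi _ _ Dp); move: (sin _) ('D_v psi p) => *; ring.
have dsin p v : D p -> 'D_v (fun q => sin (phi q)) p = C * cos (phi p) * 'D_v psi p.
  move=> Dp; have [_ ->] := is_derive_sinf v (smooth_differentiable sphi Dp).
  by rewrite (dphi _ _ Dp); move: (cos _) ('D_v psi p) => *; ring.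
have [f1 sf1 df1] := rotated_form_exact scos ssin dcos dsin.
have dcosN p v : D p -> 'D_v (fun q => - cos (phi q)) p = C * sin (phi p) * 'D_v psi p.
  move=> Dp; have [_ ->] := is_derive_oppf (is_derive_smooth v Dp scos).
  by rewrite (dcos _ _ Dp) opprK.
have dsinN p v : D p ->
    'D_v (fun q => sin (phi q)) p = - (C * (- cos (phi p)) * 'D_v psi p).
  by move=> Dp; rewrite (dsin _ _ Dp) mulrN mulNr opprK.
have [f2 sf2 df2] := rotated_form_exact ssin (smooth_opp oD scos) dsinN dcosN.
exists f1, f2; split; [exact: sf1|exact: sf2|move=> p v w Bp].
have Dp : D p by apply: le_ball Bp; rewrite ler_pdivrMr// ler_pMr// ler1n.
rewrite !(df1 _ _ Bp) !(df2 _ _ Bp) /= !mulNr !opprK.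
apply: rotated_frame_metric;
  [exact: cos2Dsin2|exact: cos2Dsin2|exact: normal|exact: normal].
Qed.

End Forms.
End FlatCoordinates.
(** * Frames of Minkowski space *)

Section LorentzFrames.
Variable R : realType.
Implicit Types (a b U v w : 'rV[R]_3).

(** Orthonormality with signature (+, +, -), in the equivalent form of a completeness relation,
    which expands any product directly. *)
Definition lorentz_frame a b U := forall v w,
  lprod v w = lprod v a * lprod w a + lprod v b * lprod w b - lprod v U * lprod w U.

Lemma lprodNr v w : lprod v (- w) = - lprod v w.
Proof. by rewrite /lprod !mxE; ring. Qed.

Lemma lorentz_frameN a b U : lorentz_frame a b U -> lorentz_frame (- a) b U.
Proof. by move=> F v w; rewrite !lprodNr mulrNN. Qed.

Lemma lorentz_frameC a b U : lorentz_frame a b U -> lorentz_frame b a U.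
Proof. by move=> F v w; rewrite F (addrC (lprod v a * _)). Qed.

(* The image of the standard frame under the Lorentz boost taking [e3] to [U]. *)
Lemma lorentz_frame_exists U : lprod U U = -1 -> future_directed U ->
  exists a b, lorentz_frame a b U.
Proof.
move=> UU [_]; rewrite {1}/lprod !mxE/= !mulr0 addr0 sub0r mulr1 oppr_lt0 => u3.
have row3 (x y z : R) : exists w : 'rV[R]_3, [/\ w 0 0 = x, w 0 1 = y & w 0 2%:R = z].
  by exists (\row_j [:: x; y; z]`_j); split; rewrite mxE.
move: UU u3; set u1 := U 0 0; set u2 := U 0 1; set u3 := U 0 2%:R => UU u3_gt0.
have UUE : u1 ^+ 2 + u2 ^+ 2 = u3 ^+ 2 - 1.
  by move: UU; rewrite /lprod -/u1 -/u2 -/u3 !expr2; lra.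
pose q := (1 + u3)^-1.
have q0 : 1 + u3 != 0 by rewrite gt_eqF// addr_gt0.
(* With [q2] and [UUE] this generates the frame identity: the difference of its two sides is
   displayed below as a combination of the three. *)
have qN : 1 + q * (u1 ^+ 2 + u2 ^+ 2) - u3 = 0 by rewrite UUE /q; field.
have q2 : 2 * q + q ^+ 2 * (u1 ^+ 2 + u2 ^+ 2) - 1 = 0 by rewrite UUE /q; field.
have [a [a1 a2 a3]] := row3 (1 + q * u1 ^+ 2) (q * u1 * u2) u1.
have [b [b1 b2 b3]] := row3 (q * u1 * u2) (1 + q * u2 ^+ 2) u2.
exists a, b => v w; rewrite /lprod a1 a2 a3 b1 b2 b3 -/u1 -/u2 -/u3.
move: (v 0 0) (v 0 1) (v 0 2%:R) (w 0 0) (w 0 1) (w 0 2%:R) => v1 v2 v3 w1 w2 w3.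
apply/eqP; rewrite eq_sym -subr_eq0; apply/eqP.
transitivity ((2 * q + q ^+ 2 * (u1 ^+ 2 + u2 ^+ 2) - 1) *
    (u1 ^+ 2 * v1 * w1 + u1 * u2 * (v1 * w2 + v2 * w1) + u2 ^+ 2 * v2 * w2)
  - (1 + q * (u1 ^+ 2 + u2 ^+ 2) - u3) *
    (u1 * (v1 * w3 + v3 * w1) + u2 * (v2 * w3 + v3 * w2))
  + (u1 ^+ 2 + u2 ^+ 2 - (u3 ^+ 2 - 1)) * v3 * w3); first by ring.
by rewrite q2 qN UUE subrr; ring.
Qed.

(** In any frame the nonzero quantity is [lprod w a ^+ 2 + lprod w b ^+ 2], so one of the two
    products is nonzero; exchanging [a] and [b] or changing a sign does the rest. *)
Lemma lorentz_frame_positive U w : lprod U U = -1 -> future_directed U ->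
  lprod w w + lprod w U ^+ 2 != 0 -> exists a b, lorentz_frame a b U /\ 0 < lprod w a.
Proof.
move=> UU fU w0; have [a [b F]] := lorentz_frame_exists UU fU.
have [wa|wa] := eqVneq (lprod w a) 0; last first.
  have [?|wa'] := ltP 0 (lprod w a); first by exists a, b.
  exists (- a), b; split; first exact: lorentz_frameN.
  by rewrite lprodNr oppr_gt0 lt_neqAle wa.
have wb : lprod w b != 0.
  by apply: contraNneq w0 => wb; rewrite F wa wb; apply/eqP; ring.
have F' := lorentz_frameC F.
have [?|wb'] := ltP 0 (lprod w b); first by exists b, a.
exists (- b), a; split; first exact: lorentz_frameN.
by rewrite lprodNr oppr_gt0 lt_neqAle wb.
Qed.

Lemma smooth_lprod (V : normedModType R) (D : set V) (X : V -> 'rV[R]_3) a :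
  open D -> smooth_on D X -> smooth_on D (fun q => lprod (X q) a).
Proof.
move=> oD /(smooth_coord _ oD) sX.
have scst (x : R) : smooth_on D (fun=> x) by exact: (smooth_cst (W := R)).
by apply: (smooth_add oD); [apply: (smooth_add oD)|apply: (smooth_opp oD)];
  apply: (smooth_mul oD).
Qed.

Lemma derive_lprod (V : normedModType R) (X : V -> 'rV[R]_3) a (q h : V) :
  differentiable X q -> 'D_h (fun q => lprod (X q) a) q = lprod ('d X q h) a.
Proof.
move=> dX; have dXv : derivable X q h by exact: diff_derivable.
have dXi i : is_derive q h (fun q => X q 0 i) ('d X q h 0 i).
  rewrite -deriveE// derive_mx// mxE; apply: derivableP.
  by have /derivable_mxP := dXv; exact.
have dXa i : is_derive q h (fun q => X q 0 i * a 0 i) ('d X q h 0 i * a 0 i).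
  rewrite (mulrC ('d X q h 0 i)); under eq_fun do rewrite mulrC.
  exact: is_derive_scalef.
by have [] := is_derive_addf (is_derive_addf (dXa 0) (dXa 1)) (is_derive_oppf (dXa 2%:R)).
Qed.

End LorentzFrames.

Section PolarAngle.
Variable R : realType.

(** On the half-plane [f > 0] the arctangent of [g / f] is a smooth branch of the angle. *)
Lemma polar_angle (V : normedModType R) (D : set V) (f g : V -> R) (S : R) :
  open D -> 0 < S -> smooth_on D f -> smooth_on D g ->
  (forall q, D q -> 0 < f q) -> (forall q, D q -> f q ^+ 2 + g q ^+ 2 = S ^+ 2) ->
  exists2 psi : V -> R, smooth_on D psi &
    forall q, D q -> S * cos (psi q) = f q /\ S * sin (psi q) = g q.
Proof.
move=> oD S0 sf sg f0 fg; pose psi q := atan (g q * (f q)^-1).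
have fn0 q : D q -> f q != 0 by move=> Dq; rewrite gt_eqF// f0.
exists psi.
  by apply: (smooth_atan oD); apply: (smooth_mul oD) => //; apply: (smooth_inv oD).
move=> q Dq; have fq := fn0 q Dq; have f0q := f0 q Dq.
have cosE : cos (psi q) = f q / S.
  rewrite cos_atan (_ : 1 + _ = (S / f q) ^+ 2); last first.
    by rewrite !expr_div_n -(fg q Dq); field.
  by rewrite sqrtr_sqr ger0_norm ?divr_ge0 ?ltW// invf_div.
have cosn0 : cos (psi q) != 0 by rewrite cosE mulf_neq0 ?invr_eq0// gt_eqF.
split; first by rewrite cosE mulrC divfK// gt_eqF.
have := atanK (g q * (f q)^-1); rewrite -/(psi q) /tan.
move=> /(congr1 ( *%R^~ (cos (psi q)))).
rewrite divfK// cosE => ->; field.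
by rewrite fq gt_eqF.
Qed.

End PolarAngle.

(** * The model plane *)

Section EuclideanPlane.
Variable R : realType.

(** The horizontal plane through the origin, on which the Lorentz product is the Euclidean one. *)
Definition euclidean_plane (q : 'rV[R]_2) : 'rV[R]_3 := q *m pid_mx 2.

Lemma diff_euclidean_plane q v : 'd euclidean_plane q v = euclidean_plane v.
Proof.
rewrite -deriveE; last exact: smooth_differentiable (smooth_mulmxr _) _.
have did : differentiable (@id 'rV[R]_2) q by [].
by rewrite (derive_mulmxr _ _ did) derive_id.
Qed.

Lemma is_plane_euclidean_plane : is_plane setT euclidean_plane.
Proof.
split=> //; last first.
  exists 0, (row 0 (pid_mx 2 : 'M[R]_(2, 3))), (row 1 (pid_mx 2 : 'M[R]_(2, 3))) => q.
  rewrite /euclidean_plane mulmx_sum_row big_ord_recl big_ord1 add0r.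
  by rewrite ord2_lift.
split; first exact: openT.
split; first exact: smooth_mulmxr.
move=> q _ v w; rewrite !diff_euclidean_plane.
move=> /(congr1 (fun u => u *m (pid_mx 2 : 'M[R]_(3, 2)))); rewrite -!mulmxA mul_pid_mx.
by rewrite (_ : pid_mx _ = 1%:M) ?mulmx1// -pid_mx_1.
Qed.

Lemma first_fundamental_form_plane q v w :
  first_fundamental_form euclidean_plane q v w = v 0 0 * w 0 0 + v 0 1 * w 0 1.
Proof.
have E (u : 'rV[R]_2) : [/\ euclidean_plane u 0 0 = u 0 0,
    euclidean_plane u 0 1 = u 0 1 & euclidean_plane u 0 2%:R = 0].
  rewrite /euclidean_plane !mxE !big_ord_recl !big_ord0 !mxE/=.
  rewrite ord2_lift.
  by rewrite (_ : ord0 = 0 :> 'I_2)//; split; ring.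
rewrite /first_fundamental_form !diff_euclidean_plane /lprod.
by have [-> -> ->] := E v; have [-> -> ->] := E w; rewrite mulr0 subr0.
Qed.

End EuclideanPlane.
(** * Change of chart *)

Section Charts.
Variables (R : realType) (T : topologicalType).
Implicit Types c : chart R T.

Lemma chart_invK c q : is_chart c -> chart_range c q ->
  chart_dom c (chart_inv c q) /\ chart_map c (chart_inv c q) = q.
Proof. by move=> [_ _ _ _ K] [t ct <-]; rewrite K. Qed.

Lemma open_preimage_within (S S' : topologicalType) (B : set S) (f : S -> S')
    (E : set S') : open B -> {within B, continuous f} -> open E ->
  open (B `&` f @^-1` E).
Proof.
move=> oB; rewrite continuous_open_subspace// => cf oE.
rewrite openE => s [Bs Es]; apply: filterI; first exact: open_nbhs_nbhs.
by apply: (cf s (mem_set Bs)); exact: open_nbhs_nbhs.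
Qed.

Lemma open_overlap c c' : is_chart c -> open (chart_dom c') ->
  open (chart_map c @` (chart_dom c `&` chart_dom c')).
Proof.
move=> Cc oc'; have [_ oR _ ci K] := Cc.
rewrite (_ : _ @` _ = chart_range c `&` chart_inv c @^-1` chart_dom c').
  exact: open_preimage_within.
apply/seteqP; split=> [_ [t [ct c't] <-]|q [Rq c'q]].
  by split; [exists t|rewrite /= K].
have [cq qE] := chart_invK Cc Rq.
by exists (chart_inv c q).
Qed.

Definition recoordinate c (B : set 'rV[R]_2) (F G : 'rV[R]_2 -> 'rV[R]_2) :=
  Chart [set t | chart_dom c t /\ B (chart_map c t)]
    (fun t => F (chart_map c t)) (fun q => chart_inv c (G q)).

Variables (A : set (chart R T)) (c : chart R T) (B : set 'rV[R]_2)
  (F G : 'rV[R]_2 -> 'rV[R]_2).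
Hypotheses (hA : smooth_atlas A) (Ac : A c) (oB : open B) (Bc : B `<=` chart_range c)
  (oFB : open (F @` B)) (GF : forall q, B q -> G (F q) = q)
  (sF : smooth_on B F) (sG : smooth_on (F @` B) G).

Let c1 := recoordinate c B F G.
Let Cc : is_chart c. Proof. by have [Cc _ _] := hA; exact: Cc. Qed.

Lemma recoordinate_range : chart_range c1 = F @` B.
Proof.
apply/seteqP; split=> [_ [t [ct Bt] <-]|_ [q Bq <-]]; first by exists (chart_map c t).
have [t ct tq] := Bc Bq; exists t; last by rewrite /= tq.
by split=> //; rewrite tq.
Qed.

Lemma recoordinate_is_chart : is_chart c1.
Proof.
have [oD oR cm ci K] := Cc.
have oD1 : open (chart_dom c1) by exact: (open_preimage_within oD cm oB).
split=> //.
- by rewrite recoordinate_range.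
- apply: continuous_in_subspaceT => t /set_mem[ct Bt].
  move: cm; rewrite continuous_open_subspace// => /(_ t (mem_set ct)) cm.
  by apply: (continuous_comp cm); exact: smooth_continuous sF Bt.
- rewrite recoordinate_range; apply: continuous_in_subspaceT => q /set_mem FBq.
  have RG : chart_range c (G q) by case: FBq => p Bp <-; rewrite GF//; exact: Bc.
  move: ci; rewrite continuous_open_subspace// => /(_ (G q) (mem_set RG)) ci.
  exact: (continuous_comp (smooth_continuous sG FBq)).
- by move=> t [ct Bt]; rewrite /= GF// K.
Qed.

(** Transitions with a chart of [A] are those of [c], preceded by [G] or followed by [F]. *)
Lemma recoordinate_smooth_chart : smooth_chart A c1.
Proof.
split=> [|c' Ac']; first exact: recoordinate_is_chart.
have [Ch _ comp] := hA; have Cc' := Ch _ Ac'.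
have [cc' c'c] := comp _ _ Ac Ac'.
have [oD oR _ _ K] := Cc; have [oD' oR' _ _ K'] := Cc'.
have C1 := recoordinate_is_chart; have [oD1 _ _ _ _] := C1.
have S1 := open_overlap C1 oD'; have S1' := open_overlap Cc' oD1.
split.
- apply: (smooth_comp (f := G)
    (g := fun q => chart_map c' (chart_inv c q)) S1 (open_overlap Cc oD')) => //.
  + move=> _ [t [[ct Bt] c't] <-]; exists t => //=.
    by rewrite GF.
  + apply: smooth_sub sG => _ [t [[ct Bt] c't] <-].
    by exists (chart_map c t).
- apply: (smooth_comp (f := fun q => chart_map c (chart_inv c' q)) (g := F) S1' oB) => //.
  + by move=> _ [t [c't [ct Bt]] <-]; rewrite K'.
  + apply: smooth_sub c'c => _ [t [c't [ct Bt]] <-].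
    by exists t.
Qed.

End Charts.

Lemma near_gt0 (R : realType) (V : normedModType R) (f : V -> R) q :
  {for q, continuous f} -> 0 < f q -> \forall p \near q, 0 < f p.
Proof. by move=> cf f0; exact: (cvgr_gt _ cf). Qed.

(** * Flat coordinates on a constant angle surface *)

Section Assemble.
Variables (R : realType) (T : topologicalType) (A : set (chart R T)) (x : T -> 'rV[R]_3).

Lemma constant_angle_flat_coordinates c q0 :
  smooth_atlas A -> spacelike_immersion A x -> constant_angle A x ->
  A c -> chart_range c q0 ->
  exists r (f1 f2 : 'rV[R]_2 -> R), [/\ 0 < r, ball q0 r `<=` chart_range c,
    smooth_on (ball q0 r) f1, smooth_on (ball q0 r) f2 &
    forall p v w, ball q0 r p -> 'D_v f1 p * 'D_w f1 p + 'D_v f2 p * 'D_w f2 p =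
      first_fundamental_form (in_chart x c) p v w].
Proof.
move=> hA [hx _] [xi [[sxi xi1 _ xin] [U [UU fU [theta htheta]]]]] Ac Dq0.
have [Ch _ _] := hA; have [_ oD _ _ _] := Ch _ Ac.
have [sX _] := hx _ Ac; have sXi := sxi _ Ac.
set D := chart_range c in oD Dq0 sX sXi *.
set X := in_chart x c in sX *.
set Xi := in_chart xi c in sXi.
pose C := coshR theta.
have C0 : 0 < C by rewrite divr_gt0// addr_gt0// expR_gt0.
have XiU q : lprod (Xi q) U = - C.
  have [_ _ _ _ ->] := htheta (chart_inv c q).
  by rewrite /lnorm xi1 UU normrN1 sqrtr1 !mul1r.
pose S := Num.sqrt (C ^+ 2 - 1).
have XiXi q : lprod (Xi q) (Xi q) = -1 by exact: xi1.
have SE a b q : lorentz_frame a b U ->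
    lprod (Xi q) a ^+ 2 + lprod (Xi q) b ^+ 2 = C ^+ 2 - 1.
  by move=> Fr; have := Fr (Xi q) (Xi q); rewrite XiXi XiU; lra.
(* [C ^+ 2 - 1] is nonnegative as a sum of two squares in some frame. *)
have S2 : S ^+ 2 = C ^+ 2 - 1.
  have [a [b Fr]] := lorentz_frame_exists UU fU.
  by rewrite sqr_sqrtr// -(SE _ _ q0 Fr) addr_ge0// sqr_ge0.
have [a [b [Fr [r [psi [r0 rD spsi psiE]]]]]] : exists a b, lorentz_frame a b U /\
    exists r psi, [/\ 0 < r, ball q0 r `<=` D, smooth_on (ball q0 r) psi &
      forall q, ball q0 r q ->
        S * cos (psi q) = lprod (Xi q) a /\ S * sin (psi q) = lprod (Xi q) b].
  (* If [S = 0], the products of the normal with [a] and [b] vanish and any [psi] would fit. *)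
  have [S0|S0] := eqVneq S 0.
    have [a [b Fr]] := lorentz_frame_exists UU fU.
    have /nbhs_ballP[r /= r0 rD] : nbhs q0 D by apply: open_nbhs_nbhs.
    exists a, b; split=> //; exists r, (fun=> 0); split=> //.
      exact: (smooth_cst (W := R)).
    move=> q _; have := SE _ _ q Fr; rewrite -S2 S0 expr0n/= => /eqP.
    rewrite paddr_eq0 ?sqr_ge0// !sqrf_eq0 => /andP[/eqP-> /eqP->].
    by rewrite !mul0r.
  have [|a [b [Fr a0]]] := @lorentz_frame_positive R U (Xi q0) UU fU.
    by rewrite XiXi XiU sqrrN addrC -S2 sqrf_eq0.
  have sXa := smooth_lprod a oD sXi.
  have /nbhs_ballP[r /= r0 rP] : nbhs q0 [set q | D q /\ 0 < lprod (Xi q) a].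
    apply: filterI; first exact: open_nbhs_nbhs.
    exact: near_gt0 (smooth_continuous sXa Dq0) a0.
  have rD : ball q0 r `<=` D by move=> q /rP[].
  exists a, b; split=> //.
  have S_gt0 : 0 < S by rewrite lt_neqAle eq_sym S0 sqrtr_ge0.
  have [||psi spsi psiE] := @polar_angle R _ (ball q0 r) _ (fun q => lprod (Xi q) b) S
     (ball_open _ _) S_gt0 (smooth_sub rD sXa) (smooth_sub rD (smooth_lprod b oD sXi)).
  - by move=> q /rP[].
  - by move=> q _; rewrite (SE _ _ _ Fr) S2.
  by exists r, psi.
have sXl u : smooth_on (ball q0 r) (fun q => lprod (X q) u).
  by apply: smooth_sub rD _; exact: smooth_lprod.
have dXl u q v : ball q0 r q ->
    'D_v (fun q => lprod (X q) u) q = lprod ('d X q v) u.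
  by move=> Bq; apply: derive_lprod; exact: smooth_differentiable sX (rD _ Bq).
have normal q v : ball q0 r q ->
    C * 'D_v (fun q => lprod (X q) U) q = - S *
      (cos (psi q) * 'D_v (fun q => lprod (X q) a) q +
       sin (psi q) * 'D_v (fun q => lprod (X q) b) q).
  move=> Bq; rewrite !(dXl _ _ _ Bq).
  (* Orthogonality of the normal to the tangent vectors, expanded in the frame. *)
  have := xin c q v Ac (rD _ Bq); rewrite -/Xi -/X Fr XiU.
  by have [<- <-] := psiE q Bq; lra.
have [f1 [f2 [sf1 sf2 f12]]] :=
  flat_coordinates r0 (sXl a) (sXl b) (sXl U) spsi (lt0r_neq0 C0) S2 normal.
have rr2 : ball q0 (r / 2) `<=` ball q0 r.
  by apply: le_ball; rewrite ler_pdivrMr// ler_pMr// ler1n.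
exists (r / 2), f1, f2; split=> //.
- by rewrite divr_gt0.
- exact: subset_trans rr2 rD.
move=> p v w Bp; rewrite f12// !(dXl _ _ _ (rr2 _ Bp)).
exact: esym (Fr _ _).
Qed.

End Assemble.
Lemma diff_comp_at (R : realType) (V W W' : normedModType R) (f : V -> W)
    (g : W -> W') q v :
  differentiable f q -> differentiable g (f q) ->
  'd (g \o f) q v = 'd g (f q) ('d f q v).
Proof. by move=> df dg; rewrite (diff_comp df dg). Qed.

Theorem corollary3p6 (R : realType) (T : topologicalType)
    (A : set (chart R T)) (x : T -> 'rV[R]_3)
    (hM : connected_smooth_surface A)
    (hx : spacelike_immersion A x)
    (hangle : constant_angle A x) :
  locally_isometric_to A x
    (fun D Y => is_plane D Y \/ is_cone D Y \/ is_cylinder D Y \/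
                is_tangent_developable D Y).
Proof.
have [_ _ _ hA] := hM; have [Ch cov _] := hA.
move=> p; have [c Ac cp] := cov p.
have [_ oD _ _ _] := Ch _ Ac.
pose q0 := chart_map c p.
have Dq0 : chart_range c q0 by exists p.
have [sX _] := hx.1 _ Ac.
have [r [f1 [f2 [r0 rD sf1 sf2 f12]]]] :=
  constant_angle_flat_coordinates hA hx hangle Ac Dq0.
have oB : open (ball q0 r) by exact: ball_open.
pose F q : 'rV[R]_2 := row2 (f1 q) (f2 q).
have sF : smooth_on (ball q0 r) F.
  apply/(smooth_coord _ oB) => j; have [->|->] := ord2 j.
    by under eq_fun do rewrite row2_0.
  by under eq_fun do rewrite row2_1.
have dF q v : ball q0 r q -> 'd F q v = row2 ('D_v f1 q) ('D_v f2 q).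
  move=> Bq; have dFq := smooth_differentiable sF Bq.
  rewrite -deriveE//; apply/rowP => j; rewrite derive_mx; last exact: diff_derivable.
  rewrite [LHS]mxE.
  have [->|->] := ord2 j; rewrite (row2_0, row2_1).
    by under eq_fun do rewrite row2_0.
  by under eq_fun do rewrite row2_1.
(* A kernel vector of the Jacobian would have zero length for [df1^2 + df2^2], the induced metric,
   which is positive definite on a spacelike surface. *)
have J0 q : ball q0 r q -> \det ('J F q) != 0.
  move=> Bq; apply/negP => /det0P[v v0 vJ].
  have := hx.2 c q v Ac (rD _ Bq) v0; rewrite -f12//.
  have : 'd F q v = 0.
    by rewrite -deriveE ?deriveEjacobian//; exact: smooth_differentiable sF Bq.
  rewrite dF// => /rowP dF0; have := dF0 0; have := dF0 1.
  by rewrite row2_0 row2_1 !mxE => -> ->; rewrite mulr0 addr0 ltxx.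
have [s [G [s0 sr oFB GF sG]]] := inverse_function oB (ballxx _ r0) sF J0.
set B := ball q0 s in sr oFB GF sG.
have oB' : open B by exact: ball_open.
have BD : B `<=` chart_range c by exact: subset_trans sr rD.
have sFB := smooth_sub sr sF.
exists (recoordinate c B F G); split; first by split=> //; exact: ballxx.
exists setT, (@euclidean_plane R); split; first by left; exact: is_plane_euclidean_plane.
split.
- exact: recoordinate_smooth_chart hA Ac oB' BD oFB GF sFB sG.
- exact: subsetT.
move=> y v w; rewrite (recoordinate_range F G BD) => -[q Bq <-] {y}.
have FBq : (F @` B) (F q) by exists q.
have dG : differentiable G (F q) by exact: smooth_differentiable sG FBq.
have dX : differentiable (in_chart x c) (G (F q)).
  by rewrite GF//; exact: smooth_differentiable sX (BD _ Bq).
have FGK u : 'd F q ('d G (F q) u) = u.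
  have dFG : differentiable F (G (F q)).
    by rewrite GF//; exact: smooth_differentiable sFB Bq.
  have := derive_comp u dG dFG; rewrite (deriveE _ dG) GF// => <-.
  rewrite (eq_on_open_derive (g := id) u oFB FBq) ?derive_id//.
  by move=> _ [q' Bq' <-]; rewrite /= GF.
rewrite first_fundamental_form_plane.
have dXG u : 'd (in_chart x (recoordinate c B F G)) (F q) u =
    'd (in_chart x c) q ('d G (F q) u).
  by have := diff_comp_at u dG dX; rewrite (GF q Bq).
transitivity (first_fundamental_form (in_chart x c) q ('d G (F q) v) ('d G (F q) w)).
  exact: (congr2 (@lprod R) (dXG v) (dXG w)).
rewrite -(f12 _ _ _ (sr _ Bq)).
(* [F] has components [f1] and [f2], so this is [FGK] read entrywise; it turns [df1^2 + df2^2] into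
   the metric of the model plane. *)
have coordE u : 'D_('d G (F q) u) f1 q = u 0 0 /\ 'D_('d G (F q) u) f2 q = u 0 1.
  have E := etrans (esym (FGK u)) (dF q _ (sr _ Bq)).
  have E0 := congr1 (fun w : 'rV[R]_2 => w 0 0) E.
  have E1 := congr1 (fun w : 'rV[R]_2 => w 0 1) E.
  by split; [rewrite E0 row2_0|rewrite E1 row2_1].
by have [-> ->] := coordE v; have [-> ->] := coordE w.
Qed.
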